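(* Let $X$ be a connected complex analytic manifold, let $q : Y \to X$ be a Galois cover with automorphism group $\pi := \mathrm{Aut}_X(Y)$, let $G$ be a complex Lie group, and let $\mathcal{G}$ be a $(\pi,G)$-group bundle on $X$. Choose a crossed morphism $\varphi : \pi \to \mathrm{Maps}(Y,\mathrm{Aut}(G))$ such that there exists an isomorphism of group bundles $\mathcal{G} \simeq \pi \backslash (Y \times G)$, where $f \in \pi$ acts to the left on $(y,g) \in Y \times G$ via $\tau_f(y,g) := (f(y), \varphi_f(y)(g))$. Then the set of isomorphism classes of right $\mathcal{G}$-torsors that become trivial as principal $G$-bundles after pullback to $Y$ is in bijection with the group cohomology set $$H^1_\varphi\big(\pi, \mathrm{Maps}(Y,G)\big) := \mathrm{Maps}(Y,G) \,\backslash\, Z^1_\varphi\big(\pi, \mathrm{Maps}(Y,G)\big).$$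
   Context: A group bundle on a complex analytic manifold $X$ is a complex analytic manifold $\mathcal{G}$ with a holomorphic map $p : \mathcal{G} \to X$ such that every fibre is a complex Lie group and every $x \in X$ has an open neighbourhood $U$ with an isomorphism of complex analytic manifolds $p^{-1}(U) \simeq U \times p^{-1}(x)$ over $U$ that is an isomorphism of complex Lie groups on each fibre. Isomorphisms of group bundles are biholomorphisms over $X$ that are group isomorphisms fibrewise. A right $\mathcal{G}$-torsor is a complex analytic manifold $\mathcal{P}$ over $X$ with a holomorphic map $\mathcal{P}\times_X\mathcal{G}\to\mathcal{P}$ over $X$ which is fibrewise a right group action, such that every point of $X$ has an open neighbourhood $U$ with a $\mathcal{G}|_U$-equivariant isomorphism $\mathcal{G}|_U\simeq\mathcal{P}|_U$ over $U$ ($\mathcal{G}|_U$ acting on itself by right translations). Morphisms of $\mathcal{G}$-torsors are $\mathcal{G}$-equivariant holomorphic maps over $X$. A Galois cover $q : Y \to X$ is a covering with $Y$ connected such that $\pi := \mathrm{Aut}_X(Y)$ acts transitively on the fibres of $q$. A $(\pi,G)$-group bundle is a group bundle $\mathcal{G}$ on $X$ with $q^*\mathcal{G} \simeq Y \times G$ as group bundles on $Y$. For such $\mathcal{G}$, the pullback $q^*\mathcal{P}$ of a $\mathcal{G}$-torsor is a $q^*\mathcal{G} \simeq Y\times G$-torsor, i.e. a principal $G$-bundle on $Y$; ''becomes trivial after pullback to $Y$'' means that this principal $G$-bundle is trivial. $\mathrm{Aut}(G)$ is the group of complex analytic group automorphisms of $G$. $\mathrm{Maps}(Y,\mathrm{Aut}(G))$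 is the group of holomorphic maps $\lambda : Y \to \mathrm{Aut}(G)$ (i.e. $(y,g)\mapsto\lambda(y)(g)$ is holomorphic) under pointwise composition. A crossed morphism $\varphi : \pi \to \mathrm{Maps}(Y,\mathrm{Aut}(G))$ is a map $f\mapsto\varphi_f$ with $\varphi_{f_1\circ f_2} = (\varphi_{f_1}\circ f_2)\cdot\varphi_{f_2}$ for all $f_1,f_2\in\pi$ (such a $\varphi$ as in the claim always exists). $\mathrm{Maps}(Y,G)$ is the group of holomorphic maps $Y \to G$ under pointwise multiplication. Given $\varphi$, the group $\pi$ acts on $\mathrm{Maps}(Y,G)$ to the right by $\mu^f(y) := \varphi_f(y)^{-1}\big(\mu(f(y))\big)$. $Z^1_\varphi(\pi,\mathrm{Maps}(Y,G))$ is the set of maps $\rho : \pi \to \mathrm{Maps}(Y,G)$, $f\mapsto\rho_f$, with $\rho_{f_1\circ f_2} = \rho_{f_1}^{f_2}\cdot\rho_{f_2}$ for all $f_1,f_2\in\pi$. The group $\mathrm{Maps}(Y,G)$ acts on it to the left by $(\mu\bullet\rho)_f := \mu^f\cdot\rho_f\cdot\mu^{-1}$. *)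

(* Defs.v *)
From HB Require Import structures.
From mathcomp Require Import all_boot all_order all_algebra.
From mathcomp Require Import complex.
From mathcomp Require Import all_classical all_reals topology normedtype landau derive.

Set Implicit Arguments.
Unset Strict Implicit.
Unset Printing Implicit Defensive.

Import Order.TTheory GRing.Theory Num.Theory.
Import numFieldNormedType.Exports.
Local Open Scope ring_scope.
Local Open Scope classical_set_scope.

Section Differentiability.
Variables (K : numFieldType).

Lemma differentiable_of_littleo (V W : normedModType K) (g : V -> W)
    (df : {linear V -> W}) (x : V) :
  continuous df -> g \o shift x = cst (g x) + df +o_ 0 id -> differentiable g x.
Proof.
move=> cdf gdf; have dgE := diff_unique cdf gdf.
apply/diff_locallyxP; split; first by rewrite dgE.
by move=> h; rewrite dgE; have /(congr1 (@^~ h)) := gdf.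
Qed.

Lemma near_eq_differentiable (V W : normedModType K) (f g : V -> W) (x : V) :
  (\near x, f x = g x) -> differentiable f x -> differentiable g x.
Proof.
move=> fg df; have gx : g x = f x by rewrite (nbhs_singleton fg).
have fo := diff_locally df.
apply: (@differentiable_of_littleo _ _ g ('d f x)); first exact: diff_continuous.
apply/eqaddoP => e e0; rewrite gx.
have /eqaddoP/(_ e e0) := fo.
have := fg; rewrite (near_shift 0 x).
by apply: filterS2 => z /=; rewrite subr0 !fctE /= => ->.
Qed.

Lemma row_mx_continuous m n :
  continuous (fun u : 'rV[K]_m * 'rV[K]_n => row_mx u.1 u.2).
Proof.
move=> [u v] A /nbhs_ballP[e /= e0 eA].
exists (ball u e, ball v e); first by split; exact: nbhsx_ballx.
move=> [a b] /= [[_ ua] [_ vb]]; apply: eA; split => // i j.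
by rewrite !mxE; case: splitP => k _.
Qed.

Lemma differentiable_row_mx (V : normedModType K) m n
    (f : V -> 'rV[K]_m) (g : V -> 'rV[K]_n) (x : V) :
  differentiable f x -> differentiable g x ->
  differentiable (fun v => row_mx (f v) (g v)) x.
Proof.
move=> df dg.
pose l := fun u : 'rV[K]_m => u *m row_mx 1%:M (0 : 'M[K]_(m, n)).
pose r := fun u : 'rV[K]_n => u *m row_mx (0 : 'M[K]_(n, m)) 1%:M.
have lE u : l u = row_mx u 0 by rewrite /l mul_mx_row mulmx1 mulmx0.
have rE u : r u = row_mx 0 u by rewrite /r mul_mx_row mulmx1 mulmx0.
have -> : (fun v => row_mx (f v) (g v)) = (l \o f) + (r \o g).
  by apply/funext => v; rewrite !fctE lE rE add_row_mx addr0 add0r.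
have cl : continuous (mulmxr (row_mx 1%:M (0 : 'M[K]_(m, n))) : 'rV_m -> _).
  move=> u; have -> : mulmxr _ = (fun u => row_mx u 0) := funext lE.
  have h : (w, (0 : 'rV[K]_n)) @[w --> u] --> (u, (0 : 'rV[K]_n)).
    move=> A [[P Q] [/= Pu /nbhs_singleton Q0] sA].
    by apply: filterS Pu => w Pw; apply: sA.
  exact: (cvg_comp _ _ h (@row_mx_continuous _ _ (u, 0))).
have cr : continuous (mulmxr (row_mx (0 : 'M[K]_(n, m)) 1%:M) : 'rV_n -> _).
  move=> u; have -> : mulmxr _ = (fun u => row_mx 0 u) := funext rE.
  have h : ((0 : 'rV[K]_m), w) @[w --> u] --> ((0 : 'rV[K]_m), u).
    move=> A [[P Q] [/= /nbhs_singleton P0 Qu] sA].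
    by apply: filterS Qu => w Qw; apply: sA.
  exact: (cvg_comp _ _ h (@row_mx_continuous _ _ (0, u))).
apply: differentiableD; apply: differentiable_comp => //.
  exact: (linear_differentiable _ cl).
exact: (linear_differentiable _ cr).
Qed.

End Differentiability.

Section ProductTopology.
Variables T U : topologicalType.

Lemma prod_hausdorff :
  hausdorff_space T -> hausdorff_space U -> hausdorff_space (T * U)%type.
Proof.
move=> hT hU [a b] [a' b'] cl; congr (_, _).
  apply: hT => A B nA nB.
  have [] := cl (A `*` setT) (B `*` setT).
  - by exists (A, setT) => //; split => //; exact: filterT.
  - by exists (B, setT) => //; split => //; exact: filterT.
  by move=> [c d] [[/= Ac _] [/= Bc _]]; exists c.
apply: hU => A B nA nB.
have [] := cl (setT `*` A) (setT `*` B).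
- by exists (setT, A) => //; split => //; exact: filterT.
- by exists (setT, B) => //; split => //; exact: filterT.
by move=> [c d] [[/= _ Ac] [/= _ Bc]]; exists d.
Qed.

Lemma openX (A : set T) (B : set U) : open A -> open B -> open (A `*` B).
Proof.
rewrite !openE => oA oB [a b] [/= Aa Bb].
by exists (A, B) => //; split; [exact: oA | exact: oB].
Qed.

Lemma prod_second_countable :
  @second_countable T -> @second_countable U -> @second_countable (T * U)%type.
Proof.
move=> [B cB [oB nB]] [C cC [oC nC]].
exists [set D.1 `*` D.2 | D in B `*` C].
  exact/(sub_countable (card_image_le _ _))/countableX.
split=> [_ [[b c] [/= Bb Cc] <-]|[x y] A [[P Q] [/= nP nQ] sA]].
  by apply: openX; [exact: oB | exact: oC].
have [b [/= Bb bx] bP] := nB _ _ nP; have [c [/= Cc cy] cQ] := nC _ _ nQ.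
exists (b `*` c); first by split; [exists (b, c) | split].
by move=> [u v] [/= bu cv]; apply: sA; split; [exact: bP | exact: cQ].
Qed.

End ProductTopology.

(* The complex numbers, with the topology of a [numFieldType]. *)
Definition CC (R : realType) : numFieldType := R[i].

(* [cinv] is the inverse of the homeomorphism [cmap : cdom -> cmap @` cdom];
   the values of [cmap] and [cinv] outside of these sets are irrelevant. *)
Record chart (R : realType) (M : topologicalType) := Chart {
  cdim : nat;
  cdom : set M;
  cmap : M -> 'rV[CC R]_cdim;
  cinv : 'rV[CC R]_cdim -> M;
  cdom_open : open cdom;
  cimg_open : open (cmap @` cdom);
  cmapK : forall x, cdom x -> cinv (cmap x) = x;
  cmap_cont : forall x, cdom x -> {for x, continuous cmap};
  cinv_cont : forall x, cdom x -> {for cmap x, continuous cinv} }.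

Arguments cinv {R M} c _.

(* Both transition maps are complex differentiable at each point of the open
   sets on which they are defined, i.e. they are holomorphic. *)
Definition compatible (R : realType) (M : topologicalType) (c d : chart R M) :=
  forall x, cdom c x -> cdom d x ->
    differentiable (cmap d \o cinv c) (cmap c x) /\
    differentiable (cmap c \o cinv d) (cmap d x).

(* The dimension may depend on the connected component; the atlas need not be
   maximal. *)
Record cmanifold (R : realType) := CManifold {
  cm_space :> topologicalType;
  cm_hausdorff : hausdorff_space cm_space;
  cm_second_countable : @second_countable cm_space;
  atlas : set (chart R cm_space);
  atlas_cover : forall x, exists2 c, atlas c & cdom c x;
  atlas_compatible : forall c d, atlas c -> atlas d -> compatible c d }.

Section ProductManifold.
Variables (R : realType).

Section ProductChart.
Variables (M N : topologicalType) (c : chart R M) (d : chart R N).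

Let map (x : M * N) := row_mx (cmap c x.1) (cmap d x.2).
Let inv (v : 'rV[CC R]_(cdim c + cdim d)) := (cinv c (lsubmx v), cinv d (rsubmx v)).

Fact prod_cdom_open : open (cdom c `*` cdom d).
Proof. by apply: openX; exact: cdom_open. Qed.

Fact prod_cimg_open : open (map @` (cdom c `*` cdom d)).
Proof.
rewrite (_ : _ @` _ = (lsubmx @^-1` (cmap c @` cdom c)) `&`
                      (rsubmx @^-1` (cmap d @` cdom d))); last first.
  apply/seteqP; split=> [_ [[x y] [/= cx dy] <-]|v [[x cx xv] [y dy yv]]].
    by split; [exists x => //; rewrite row_mxKl | exists y => //; rewrite row_mxKr].
  by exists (x, y) => //; rewrite /map /= xv yv hsubmxK.
apply: openI; apply: open_comp; try exact: cimg_open.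
- by move=> v _; exact: continuous_lsubmx.
- by move=> v _; exact: continuous_rsubmx.
Qed.

Fact prod_cmapK x : (cdom c `*` cdom d) x -> inv (map x) = x.
Proof.
by case: x => x y [/= cx dy]; rewrite /inv /map row_mxKl row_mxKr !cmapK.
Qed.

Fact prod_cmap_cont x : (cdom c `*` cdom d) x -> {for x, continuous map}.
Proof.
case: x => x y [/= cx dy]; rewrite /continuous_at /map.
apply: continuous2_cvg; first exact: (@row_mx_continuous _ _ _ (_, _)).
  move=> A /(cmap_cont cx) nA; exists (cmap c @^-1` A, setT); last by move=> ? [].
  by split => //; exact: filterT.
move=> A /(cmap_cont dy) nA; exists (setT, cmap d @^-1` A); last by move=> ? [].
by split => //; exact: filterT.
Qed.

Fact prod_cinv_cont x : (cdom c `*` cdom d) x -> {for map x, continuous inv}.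
Proof.
case: x => x y [/= cx dy] A [[P Q] [/= nP nQ] sA].
have lP := @continuous_lsubmx (CC R) 1 (cdim c) (cdim d) (map (x, y)).
have rQ := @continuous_rsubmx (CC R) 1 (cdim c) (cdim d) (map (x, y)).
rewrite /map /continuous_at row_mxKl in nP lP.
rewrite /map /continuous_at row_mxKr in nQ rQ.
have nlP : nbhs (map (x, y)) (lsubmx @^-1` (cinv c @^-1` P)).
  exact: lP (cinv_cont cx nP).
have nrQ : nbhs (map (x, y)) (rsubmx @^-1` (cinv d @^-1` Q)).
  exact: rQ (cinv_cont dy nQ).
rewrite nbhs_filterE; apply: filterS2 nlP nrQ => v vP vQ.
exact: (sA (_, _)).
Qed.

Definition prod_chart : chart R (M * N)%type :=
  Chart prod_cdom_open prod_cimg_open prod_cmapK prod_cmap_cont prod_cinv_cont.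

End ProductChart.

Lemma prod_chart_differentiable (M N : topologicalType)
    (c c' : chart R M) (d d' : chart R N) x y :
  differentiable (cmap c' \o cinv c) (cmap c x) ->
  differentiable (cmap d' \o cinv d) (cmap d y) ->
  differentiable (cmap (prod_chart c' d') \o cinv (prod_chart c d))
    (cmap (prod_chart c d) (x, y)).
Proof.
move=> dc dd.
apply: (@differentiable_row_mx _ _ _ _
  ((cmap c' \o cinv c) \o lsubmx) ((cmap d' \o cinv d) \o rsubmx)).
  by apply: differentiable_comp;
    [exact: differentiable_lsubmx | rewrite /= row_mxKl].
by apply: differentiable_comp;
  [exact: differentiable_rsubmx | rewrite /= row_mxKr].
Qed.

Variables M N : cmanifold R.

Let prod_atlas : set (chart R (M * N)%type) :=
  [set prod_chart cd.1 cd.2 | cd in @atlas R M `*` @atlas R N].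

Fact prod_atlas_cover x : exists2 c, prod_atlas c & cdom c x.
Proof.
have [c Ac cx] := atlas_cover x.1; have [d Ad dx] := atlas_cover x.2.
by exists (prod_chart c d); [exists (c, d) | split].
Qed.

Fact prod_atlas_compatible c d : prod_atlas c -> prod_atlas d -> compatible c d.
Proof.
move=> [[c1 c2] [/= A1 A2] <-] [[d1 d2] [/= B1 B2] <-] [x y] [/= cx cy] [/= dx dy].
have [h1 h1'] := atlas_compatible A1 B1 cx dx.
have [h2 h2'] := atlas_compatible A2 B2 cy dy.
by split; exact: prod_chart_differentiable.
Qed.

Definition prodM : cmanifold R := @CManifold R (M * N)%type
  (prod_hausdorff (@cm_hausdorff R M) (@cm_hausdorff R N))
  (prod_second_countable (cm_second_countable M) (cm_second_countable N))
  prod_atlas prod_atlas_cover prod_atlas_compatible.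

End ProductManifold.

Section Holomorphy.
Variables (R : realType).
Implicit Types M N P : cmanifold R.

Definition cdifferentiable M N (f : M -> N) (x : M) :=
  {for x, continuous f} /\
  forall c d, @atlas R M c -> @atlas R N d -> cdom c x -> cdom d (f x) ->
    differentiable (cmap d \o f \o cinv c) (cmap c x).

Definition holomorphic M N (f : M -> N) := forall x, cdifferentiable f x.

(* Holomorphy of the restriction [f : S -> N], for [S] an open subset or a
   submanifold of [M]: locally, [f] extends to a holomorphic map on an open
   subset of [M].  Only the values of [f] on [S] matter. *)
Definition holomorphic_on M N (S : set M) (f : M -> N) :=
  forall x, S x -> exists g : M -> N,
    (\forall z \near x, cdifferentiable g z) /\
    (\forall z \near x, S z -> g z = f z).

(* [f : A -> B] is an isomorphism of complex manifolds with inverse [g]. *)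
Definition biholomorphic_on M N (f : M -> N) (g : N -> M) (A : set M) (B : set N) :=
  [/\ (forall x, A x -> B (f x) /\ g (f x) = x),
      (forall y, B y -> A (g y) /\ f (g y) = y),
      holomorphic_on A f & holomorphic_on B g].

(* Around each of its points, [S] is the zero locus of some of the coordinates
   of a chart compatible with the atlas. *)
Definition submanifold M (S : set M) :=
  forall x, S x -> exists c : chart R M,
    [/\ cdom c x, (forall d, @atlas R M d -> compatible c d) &
        exists I : {set 'I_(cdim c)}, forall y, cdom c y ->
          (S y <-> forall i, i \in I -> cmap c y 0 i = 0)].

Definition connected_manifold M := [set: M] !=set0 /\ connected [set: M].

Lemma cdifferentiable_comp M N P (f : M -> N) (g : N -> P) x :
  cdifferentiable f x -> cdifferentiable g (f x) -> cdifferentiable (g \o f) x.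
Proof.
move=> [cf df] [cg dg]; split.
  by move=> A /cg /cf.
move=> c d Ac Ad cx dx; have [e Ae ex] := atlas_cover (f x).
have fcx : f (cinv c (cmap c x)) = f x by rewrite cmapK.
have := @differentiable_comp _ _ _ _ (cmap e \o f \o cinv c)
  (cmap d \o g \o cinv e) (cmap c x) (df _ _ Ac Ae cx ex).
rewrite /= fcx => /(_ (dg _ _ Ae Ad ex dx)).
apply: near_eq_differentiable.
have ccx := cinv_cont cx; rewrite /prop_for /continuous_at cmapK // in ccx.
have ne : nbhs (f x) (cdom e).
  by apply: open_nbhs_nbhs; split => //; exact: cdom_open.
have nez : nbhs (cmap c x) (cinv c @^-1` (f @^-1` cdom e)) := ccx _ (cf _ ne).
by apply: filterS nez => z ez; rewrite /= cmapK.
Qed.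

Lemma holomorphic_comp M N P (f : M -> N) (g : N -> P) :
  holomorphic f -> holomorphic g -> holomorphic (g \o f).
Proof. by move=> hf hg x; apply: cdifferentiable_comp. Qed.

End Holomorphy.

Definition group_laws (T : Type) (S : set T) (mul : T -> T -> T) (e : T)
    (inv : T -> T) :=
  [/\ [/\ S e, (forall a b, S a -> S b -> S (mul a b)) &
          forall a, S a -> S (inv a)],
      (forall a b c, S a -> S b -> S c -> mul a (mul b c) = mul (mul a b) c),
      (forall a, S a -> mul e a = a /\ mul a e = a) &
      forall a, S a -> mul (inv a) a = e /\ mul a (inv a) = e].

Record lie_group (R : realType) := LieGroup {
  lg_man :> cmanifold R;
  lg_mul : lg_man -> lg_man -> lg_man;
  lg_one : lg_man;
  lg_inv : lg_man -> lg_man;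
  lg_laws : group_laws setT lg_mul lg_one lg_inv;
  lg_mul_holo :
    holomorphic (fun ab : prodM lg_man lg_man => lg_mul ab.1 ab.2);
  lg_inv_holo : holomorphic lg_inv }.

Definition fibre (T X : Type) (p : T -> X) (x : X) : set T := [set t | p t = x].

(* The subset [A x_X B] of [A x B]. *)
Definition fibre_product (A B X : Type) (a : A -> X) (b : B -> X) : set (A * B) :=
  [set uv | a uv.1 = b uv.2].

(* The fibrewise operations are given by total functions, whose values matter
   only on elements of a common fibre. *)
Record group_bundle (R : realType) (X : cmanifold R) := GroupBundle {
  gb_tot :> cmanifold R;
  gb_proj : gb_tot -> X;
  gb_mul : gb_tot -> gb_tot -> gb_tot;
  gb_one : X -> gb_tot;
  gb_inv : gb_tot -> gb_tot;
  gb_proj_holo : holomorphic gb_proj;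
  gb_laws : forall x, group_laws (fibre gb_proj x) gb_mul (gb_one x) gb_inv;
  gb_fibre_submanifold : forall x, submanifold (fibre gb_proj x);
  gb_fibre_mul_holo : forall x,
    @holomorphic_on R (prodM gb_tot gb_tot) gb_tot
      (fibre gb_proj x `*` fibre gb_proj x) (fun ab => gb_mul ab.1 ab.2);
  gb_fibre_inv_holo : forall x, holomorphic_on (fibre gb_proj x) gb_inv;
  gb_locally_trivial : forall x, exists (U : set X)
      (F : gb_tot -> prodM X gb_tot) (F' : prodM X gb_tot -> gb_tot),
    [/\ open U /\ U x,
        biholomorphic_on F F' (gb_proj @^-1` U) (U `*` fibre gb_proj x),
        (forall a, U (gb_proj a) -> (F a).1 = gb_proj a) &
        forall a b, U (gb_proj a) -> gb_proj a = gb_proj b ->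
          (F (gb_mul a b)).2 = gb_mul (F a).2 (F b).2] }.

Definition group_bundle_iso (R : realType) (X : cmanifold R)
    (A B : group_bundle X) :=
  exists (F : A -> B) (F' : B -> A),
    [/\ biholomorphic_on F F' setT setT,
        (forall a, gb_proj (F a) = gb_proj a) &
        forall a b, gb_proj a = gb_proj b ->
          F (gb_mul a b) = gb_mul (F a) (F b)].

Section Galois.
Variables (R : realType) (X Y : cmanifold R) (q : Y -> X).

Definition covering :=
  holomorphic q /\
  forall x, exists (U : set X) (D : set (set Y)),
    [/\ open U /\ U x, D !=set0 /\ (forall V, D V -> open V),
        trivIset D id, \bigcup_(V in D) V = q @^-1` U &
        forall V, D V -> exists s : X -> Y, biholomorphic_on q s V U].

(* The elements of Aut_X(Y), whose group law is [deck_comp] below. *)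
Record deck := Deck {
  deck_fun :> Y -> Y;
  deck_inv : Y -> Y;
  deck_funK : cancel deck_fun deck_inv;
  deck_invK : cancel deck_inv deck_fun;
  deck_holo : holomorphic deck_fun;
  deck_inv_holo : holomorphic deck_inv;
  deck_over : forall y, q (deck_fun y) = q y }.

Fact deck_comp_over (f g : deck) y : q ((f \o g) y) = q y.
Proof. by rewrite /= !deck_over. Qed.

Definition deck_comp (f g : deck) : deck :=
  Deck (can_comp (deck_funK f) (deck_funK g))
       (can_comp (deck_invK g) (deck_invK f))
       (holomorphic_comp (deck_holo g) (deck_holo f))
       (holomorphic_comp (deck_inv_holo f) (deck_inv_holo g))
       (deck_comp_over f g).

Definition galois_cover :=
  [/\ connected_manifold Y, covering &
      forall y y', q y = q y' -> exists f : deck, f y = y'].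

(* A (pi, G)-group bundle, together with an isomorphism of group bundles
   from Y x G to its pullback to Y. *)
Record pi_group_bundle (G : lie_group R) := PiGroupBundle {
  pg_bundle :> group_bundle X;
  pg_iso : prodM Y G -> prodM Y pg_bundle;
  pg_iso_inv : prodM Y pg_bundle -> prodM Y G;
  pg_iso_biholo : biholomorphic_on pg_iso pg_iso_inv
    setT (fibre_product q (@gb_proj R X pg_bundle));
  pg_iso_over : forall y g, (pg_iso (y, g)).1 = y;
  pg_iso_mul : forall y g h,
    (pg_iso (y, lg_mul g h)).2 = gb_mul (pg_iso (y, g)).2 (pg_iso (y, h)).2 }.

End Galois.

Section Torsors.
Variables (R : realType) (X : cmanifold R) (B : group_bundle X).

(* The action is given by a total function, whose values matter only on
   the fibre product of [to_tot] and [B] over [X]. *)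
Record torsor := Torsor {
  to_tot :> cmanifold R;
  to_proj : to_tot -> X;
  to_act : to_tot -> B -> to_tot;
  to_proj_holo : holomorphic to_proj;
  to_act_holo : @holomorphic_on R (prodM to_tot B) to_tot
    (fibre_product to_proj (@gb_proj R X B)) (fun ub => to_act ub.1 ub.2);
  to_act_over : forall u b, to_proj u = gb_proj b ->
    to_proj (to_act u b) = to_proj u;
  to_act_one : forall u, to_act u (gb_one B (to_proj u)) = u;
  to_act_mul : forall u a b, to_proj u = gb_proj a -> to_proj u = gb_proj b ->
    to_act u (gb_mul a b) = to_act (to_act u a) b;
  to_locally_trivial : forall x, exists (U : set X) (F : B -> to_tot)
      (F' : to_tot -> B),
    [/\ open U /\ U x,
        biholomorphic_on F F' (@gb_proj R X B @^-1` U) (to_proj @^-1` U),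
        (forall a, U (gb_proj a) -> to_proj (F a) = gb_proj a) &
        forall a b, U (gb_proj a) -> gb_proj a = gb_proj b ->
          F (gb_mul a b) = to_act (F a) b] }.

Definition torsor_morphism (P Q : torsor) (F : P -> Q) :=
  [/\ holomorphic F, (forall u, to_proj (F u) = to_proj u) &
      forall u b, to_proj u = gb_proj b -> F (to_act u b) = to_act (F u) b].

Definition torsor_iso (P Q : torsor) :=
  exists (F : P -> Q) (F' : Q -> P),
    [/\ torsor_morphism F, torsor_morphism F', cancel F F' & cancel F' F].

End Torsors.

(* The quotient set of [T] by [E].  The equivalence classes are not given type
   [set T], because the universe of [set] does not accommodate torsors. *)
Definition eq_classes (T : Type) (E : T -> T -> Prop) :=
  {A : T -> Prop | exists x, A = E x}.

Section PullbackTrivial.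
Variables (R : realType) (X Y : cmanifold R) (q : Y -> X) (G : lie_group R).
Variable (B : pi_group_bundle q G).

(* The pullback of [P] to [Y] is the subset [fibre_product q to_proj] of Y x P,
   and G acts on it through [pg_iso]. *)
Definition trivial_pullback (P : torsor B) :=
  exists (F : prodM Y G -> prodM Y P) (F' : prodM Y P -> prodM Y G),
    [/\ biholomorphic_on F F' setT (fibre_product q (@to_proj R X B P)),
        (forall y g, (F (y, g)).1 = y) &
        forall y g h,
          (F (y, lg_mul g h)).2 = to_act (F (y, g)).2 (pg_iso B (y, h)).2].

Definition torsor_classes :=
  eq_classes (fun P Q : {P : torsor B | trivial_pullback P} =>
    torsor_iso (proj1_sig P) (proj1_sig Q)).

End PullbackTrivial.

Record lie_aut (R : realType) (G : lie_group R) := LieAut {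
  la_fun :> G -> G;
  la_inv : G -> G;
  la_funK : cancel la_fun la_inv;
  la_invK : cancel la_inv la_fun;
  la_holo : holomorphic la_fun;
  la_inv_holo : holomorphic la_inv;
  la_mul : forall g h, la_fun (lg_mul g h) = lg_mul (la_fun g) (la_fun h) }.

Record maps_aut (R : realType) (Y : cmanifold R) (G : lie_group R) := MapsAut {
  ma_fun :> Y -> lie_aut G;
  ma_holo : @holomorphic R (prodM Y G) G (fun yg => ma_fun yg.1 yg.2) }.

Record maps (R : realType) (Y : cmanifold R) (G : lie_group R) := Maps {
  maps_fun :> Y -> G;
  maps_holo : holomorphic maps_fun }.

Section Cohomology.
Variables (R : realType) (X Y : cmanifold R) (q : Y -> X) (G : lie_group R).
Variable (phi : deck q -> maps_aut Y G).

Definition crossed_morphism := forall (f1 f2 : deck q) (y : Y) (g : G),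
  phi (deck_comp f1 f2) y g = phi f1 (f2 y) (phi f2 y g).

Definition tau (f : deck q) (yg : prodM Y G) : prodM Y G :=
  (f yg.1, phi f yg.1 yg.2).

(* [k] exhibits the group bundle [Q] as the quotient pi \ (Y x G): it
   identifies [Q] with the set of orbits, the complex structure of [Q] is the
   one for which [k] is locally biholomorphic, and the projection to [X] and
   the fibrewise multiplication are induced by those of Y x G. *)
Definition quotient_bundle (Q : group_bundle X) (k : prodM Y G -> Q) :=
  [/\ (forall b, exists a, k a = b),
      (forall a a', k a = k a' <-> exists f, tau f a = a'),
      (forall a, exists (V : set (prodM Y G)) (s : Q -> prodM Y G),
        [/\ open V /\ V a, open (k @` V) & biholomorphic_on k s V (k @` V)]),
      (forall y g, gb_proj (k (y, g)) = q y) &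
      forall y g h, k (y, lg_mul g h) = gb_mul (k (y, g)) (k (y, h))].

(* The value at [y] of mu^f. *)
Definition maps_act (mu : maps Y G) (f : deck q) (y : Y) : G :=
  la_inv (phi f y) (mu (f y)).

Record cocycle := Cocycle {
  co_fun :> deck q -> maps Y G;
  co_cocycle : forall (f1 f2 : deck q) (y : Y),
    co_fun (deck_comp f1 f2) y =
    lg_mul (maps_act (co_fun f1) f2 y) (co_fun f2 y) }.

(* rho' = mu . rho for some mu: the classes are the orbits of Maps(Y, G). *)
Definition cohomologous (rho rho' : cocycle) :=
  exists mu : maps Y G, forall (f : deck q) (y : Y),
    rho' f y = lg_mul (lg_mul (maps_act mu f y) (rho f y)) (lg_inv (mu y)).

Definition H1 := eq_classes cohomologous.

End Cohomology.

(* Main.v *)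
From HB Require Import structures.
Require Import Defs.
From mathcomp Require Import all_boot all_order all_algebra.
From mathcomp Require Import all_classical all_reals topology normedtype.
From mathcomp Require Import derive.

(** Why torsors trivialized by the cover are classified by cocycles.

    A trivialization of the pullback of a torsor [P] to [Y] is the same as a
    section of that pullback, that is, a holomorphic map [s : Y -> P] over [X]
    ([trivial_pullback_section], [section_trivial_pullback]). The isomorphism of
    [B] with the quotient of [Y * G] gives coordinates: an equivariant
    isomorphism [fr] from [Y * G] to the pullback of [B] ([frame]), through which
    [G] acts on the right on the pullback of [P], freely and transitively over
    each point of [Y] ([ract]). For a deck transformation [f], both [s] and
    [s \o f] are sections of the pullback, so
    [ract (s (f y)) y (rho f y) = s y] for a unique function [rho f], and the
    [rho f] form a cocycle ([lifts_cover_cocycle]). The bijection relates [P] to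
    the cocycles of its sections ([has_cocycle]).

    Changing the section by a function [mu : Y -> G] replaces [rho] by its
    translate under [mu], so the cocycles of one torsor form exactly one
    cohomology class ([has_cocycle_cohomologous], [cohomologous_has_cocycle]).
    If sections [s] of [P] and [s'] of [Q] have the same cocycle, then
    [s y . b |-> s' y . b] does not depend on the point [y] of the fibre of the
    cover, and is an isomorphism from [P] to [Q] ([has_cocycle_iso]). Holomorphy
    of these constructions rests on that of the division [(u, v) |-> u^-1 v] in a
    torsor ([tdiv_holo]) and of the coordinates of [B] ([quotient_coord_holo]).

    It remains to realize a cocycle [rho] by a torsor. The usual construction is
    the quotient of [Y * G] by a twisted action. It can be described on the set
    [B] itself: without holomorphy, [rho] is the coboundary of some
    [t : Y -> G] ([cocycle_set_trivial]). A local section [s i] of the cover,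
    defined on an open set [U i] of [X], gives the section
    [x |-> fr (s i x) (t (s i x))] of [B], and left translation by it is a
    bijection [twist i] of [B] which commutes with the right translations. Two
    of these differ by left translation by a section built from some [rho f],
    which is holomorphic ([untwist_twist]). So there is a complex structure on
    the set [B] in which all the [twist i] are biholomorphic over [U i]
    ([glueM]); with right translations, it is the torsor sought, and
    [y |-> fr y (t y)] is a section with cocycle [rho]
    ([twisted_torsor_cocycle]). *)

Set Implicit Arguments.
Unset Strict Implicit.
Unset Printing Implicit Defensive.

Import numFieldNormedType.Exports.
Local Open Scope classical_set_scope.

(** * Calculus of holomorphic maps *)

Section HolomorphicCalculus.
Variable R : realType.
Implicit Types L M N P : cmanifold R.

Lemma near_cdifferentiable M N (f g : M -> N) (x : M) :
  (\near x, f x = g x) -> cdifferentiable f x -> cdifferentiable g x.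
Proof.
move=> fg [cf df]; have fgx : f x = g x := nbhs_singleton fg.
split.
  move=> A; rewrite -fgx => /cf nA; rewrite /nbhs /=.
  by near=> z; rewrite /= -(near fg z) //; near: z.
move=> c d Ac Ad cx; rewrite -fgx => dx.
apply: near_eq_differentiable (df _ _ Ac Ad cx dx).
have ccx := cinv_cont cx; rewrite /prop_for /continuous_at cmapK // in ccx.
have : nbhs (cmap c x) (cinv c @^-1` [set z | f z = g z]) := ccx _ fg.
by apply: filterS => z /= ->.
Unshelve. all: by end_near. Qed.

Lemma cdifferentiable_id M (x : M) : cdifferentiable (@idfun M) x.
Proof.
split=> [A //|c d Ac Ad cx dx].
by have [] := atlas_compatible Ac Ad cx dx.
Qed.

Lemma cdifferentiable_cst M N (a : N) (x : M) :
  cdifferentiable (fun _ : M => a) x.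
Proof.
split=> [|c d Ac Ad cx dx]; first exact: cvg_cst.
exact: differentiable_cst.
Qed.

Lemma cdifferentiable_fst M N (x : prodM M N) :
  @cdifferentiable R (prodM M N) M fst x.
Proof.
split; first exact: cvg_fst.
move=> _ d [[c1 c2] [/= Ac1 Ac2] <-] Ad [/= c1x c2x] dx.
apply: (@differentiable_comp _ _ _ _ lsubmx (cmap d \o cinv c1)).
  exact: differentiable_lsubmx.
by rewrite /= row_mxKl; have [] := atlas_compatible Ac1 Ad c1x dx.
Qed.

Lemma cdifferentiable_snd M N (x : prodM M N) :
  @cdifferentiable R (prodM M N) N snd x.
Proof.
split; first exact: cvg_snd.
move=> _ d [[c1 c2] [/= Ac1 Ac2] <-] Ad [/= c1x c2x] dx.
apply: (@differentiable_comp _ _ _ _ rsubmx (cmap d \o cinv c2)).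
  exact: differentiable_rsubmx.
by rewrite /= row_mxKr; have [] := atlas_compatible Ac2 Ad c2x dx.
Qed.

Lemma cdifferentiable_pair L M N (f : L -> M) (g : L -> N) (x : L) :
  cdifferentiable f x -> cdifferentiable g x ->
  @cdifferentiable R L (prodM M N) (fun z => (f z, g z)) x.
Proof.
move=> [cf df] [cg dg]; split.
  exact: cvg_pair.
move=> c _ Ac [[d1 d2] [/= Ad1 Ad2] <-] cx [/= d1x d2x].
by apply: (@differentiable_row_mx _ _ _ _ (cmap d1 \o f \o cinv c));
  [exact: df | exact: dg].
Qed.

Lemma holomorphic_continuous M N (f : M -> N) : holomorphic f -> continuous f.
Proof. by move=> hf x; case: (hf x). Qed.

Lemma open_preimage_nbhs M N (f : M -> N) (U : set N) x :
  holomorphic f -> open U -> U (f x) -> nbhs x (f @^-1` U).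
Proof.
move=> /holomorphic_continuous cf oU Ufx.
by apply: cf; exact: open_nbhs_nbhs.
Qed.

Lemma holomorphic_id M : holomorphic (@idfun M).
Proof. by move=> x; exact: cdifferentiable_id. Qed.

Lemma holomorphic_holomorphic_on M N (S : set M) (f : M -> N) :
  holomorphic f -> holomorphic_on S f.
Proof. by move=> hf x _; exists f; split; apply: nearW. Qed.

Lemma cdifferentiable_holomorphic_on M N (S : set M) (f : M -> N) :
  open S -> (forall x, S x -> cdifferentiable f x) -> holomorphic_on S f.
Proof.
move=> oS hf x Sx; exists f; split; last exact: nearW.
by apply: filterS (open_nbhs_nbhs (conj oS Sx)) => z /hf.
Qed.

Lemma holomorphic_on_cdifferentiable M N (S : set M) (f : M -> N) x :
  holomorphic_on S f -> nbhs x S -> cdifferentiable f x.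
Proof.
move=> hf nS; have [g [/nbhs_singleton dg gf]] := hf _ (nbhs_singleton nS).
apply: near_cdifferentiable dg.
by apply: filterS2 gf nS => z; apply.
Qed.

Lemma holomorphic_on_setT M N (f : M -> N) :
  holomorphic_on setT f -> holomorphic f.
Proof.
by move=> hf x; apply: holomorphic_on_cdifferentiable hf _; exact: filterT.
Qed.

Lemma eq_holomorphic_on M N (S : set M) (f g : M -> N) :
  (forall x, S x -> f x = g x) -> holomorphic_on S f -> holomorphic_on S g.
Proof.
move=> fg hf x /hf[h [dh hE]]; exists h; split=> //.
by apply: filterS hE => z hz Sz; rewrite -fg// hz.
Qed.

Lemma holomorphic_on_local M N (S : set M) (f : M -> N) :
  (forall x, S x -> exists2 W, nbhs x W & holomorphic_on (S `&` W) f) ->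
  holomorphic_on S f.
Proof.
move=> hf x Sx; have [W nW /(_ x)[]] := hf x Sx.
  by split=> //; exact: nbhs_singleton.
move=> g [dg gf]; exists g; split=> //.
by apply: filterS2 nW gf => z Wz gz Sz; exact: gz.
Qed.

(** A composite of local extensions is a local extension of the composite: by
    continuity at [x] the first extension maps a neighbourhood of [x] into the
    domain of the second one. *)
Lemma holomorphic_on_comp M N P (S : set M) (T : set N) (f : M -> N)
    (g : N -> P) :
  (forall x, S x -> T (f x)) -> holomorphic_on S f -> holomorphic_on T g ->
  holomorphic_on S (g \o f).
Proof.
move=> ST hf hg x Sx.
have [f1 [df1 f1E]] := hf x Sx; have [g1 [dg1 g1E]] := hg _ (ST _ Sx).
have f1x : f1 x = f x by exact: (nbhs_singleton f1E).
have [cf1 _] := nbhs_singleton df1.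
rewrite /prop_for /continuous_at f1x in cf1.
exists (g1 \o f1); split.
  have n1 : nbhs x (f1 @^-1` [set z | cdifferentiable g1 z]) := cf1 _ dg1.
  by apply: filterS2 df1 n1 => z; exact: cdifferentiable_comp.
have n1 : nbhs x (f1 @^-1` [set z | T z -> g1 z = g z]) := cf1 _ g1E.
by apply: filterS2 f1E n1 => z fz gz Sz; rewrite /= gz fz//; exact: ST.
Qed.

Lemma holomorphic_on_pair L M N (S : set L) (f : L -> M) (g : L -> N) :
  holomorphic_on S f -> holomorphic_on S g ->
  @holomorphic_on R L (prodM M N) S (fun z => (f z, g z)).
Proof.
move=> hf hg x Sx.
have [f1 [df1 f1E]] := hf x Sx; have [g1 [dg1 g1E]] := hg x Sx.
exists (fun z => (f1 z, g1 z)); split.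
  by apply: filterS2 df1 dg1 => z; exact: cdifferentiable_pair.
by apply: filterS2 f1E g1E => z fz gz Sz; rewrite fz// gz.
Qed.

Lemma holomorphic_on_comp2 L M N P (S : set L) (T : set (M * N))
    (h : M -> N -> P) (f : L -> M) (g : L -> N) :
  @holomorphic_on R (prodM M N) P T (fun ab => h ab.1 ab.2) ->
  (forall x, S x -> T (f x, g x)) -> holomorphic_on S f ->
  holomorphic_on S g -> holomorphic_on S (fun x => h (f x) (g x)).
Proof.
move=> hh ST hf hg.
exact: (@holomorphic_on_comp _ (prodM M N) _ _ T (fun x => (f x, g x)) _ ST
  (holomorphic_on_pair hf hg) hh).
Qed.

Lemma holomorphic_on_proj1 M N (S : set (M * N)) :
  @holomorphic_on R (prodM M N) M S fst.
Proof. by apply: holomorphic_holomorphic_on => ?; exact: cdifferentiable_fst. Qed.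

Lemma holomorphic_on_proj2 M N (S : set (M * N)) :
  @holomorphic_on R (prodM M N) N S snd.
Proof. by apply: holomorphic_holomorphic_on => ?; exact: cdifferentiable_snd. Qed.

Lemma holomorphic_on_snd L M N (S : set L) (f : L -> prodM M N) :
  holomorphic_on S f -> @holomorphic_on R L N S (fun z => (f z).2).
Proof.
move=> hf; apply: (@holomorphic_on_comp _ _ _ _ setT f snd) => //.
exact: holomorphic_on_proj2.
Qed.

Lemma holomorphic_on_id M (S : set M) : holomorphic_on S (@idfun M).
Proof. exact/holomorphic_holomorphic_on/holomorphic_id. Qed.

Lemma holomorphic_on_cst M N (S : set M) (a : N) :
  holomorphic_on S (fun _ : M => a).
Proof.
by apply: holomorphic_holomorphic_on => x; exact: cdifferentiable_cst.
Qed.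

End HolomorphicCalculus.

(** * Galois covers *)

Section Cover.
Variables (R : realType) (X Y : cmanifold R) (q : Y -> X).

Lemma covering_surjective : covering q -> forall x, exists y, q y = x.
Proof.
move=> [_ cq] x; have [U [D [[_ Ux] [[V DV] _] _ _ sq]]] := cq x.
have [s [_ sU _ _]] := sq _ DV.
by exists (s x); have [] := sU _ Ux.
Qed.

(** The section is given on all of [X] and is only holomorphic on [U]: an
    arbitrary set-theoretic section fills in the rest, so that formulas in [s]
    make sense everywhere. *)
Lemma covering_section (y0 : Y) : covering q ->
  exists (U : set X) (V : set Y) (s : X -> Y),
    [/\ open U, open V /\ V y0, (forall x, q (s x) = x), holomorphic_on U s &
        forall y, V y -> U (q y) /\ s (q y) = y].
Proof.
move=> cq; have [r rK] := choice (covering_surjective cq).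
have [U [D [[oU Ux] [_ oD] _ DE sq]]] := cq.2 (q y0).
have [V DV Vy0] : (\bigcup_(V in D) V) y0 by rewrite DE.
have [s [qV sU _ hs]] := sq _ DV.
exists U, V, (fun x => if asbool (U x) then s x else r x); split=> //.
- by split=> //; exact: oD.
- by move=> x; case: asboolP => // /sU[].
- by apply: eq_holomorphic_on hs => x Ux'; case: asboolP.
- by move=> y /qV[Uy sy]; split=> //; case: asboolP.
Qed.

Lemma deck_ext (f g : deck q) : (forall y, f y = g y) -> f = g.
Proof.
case: f g => [f f' fK f'K hf hf' qf] [g g' gK g'K hg hg' qg] /= /funext fg.
have f'g' : f' = g' by apply/funext => y; rewrite -{1}(g'K y) -fg fK.
by subst g g'; congr Deck; exact: Prop_irrelevance.
Qed.

(** Agreement of two deck transformations is a closed condition because [Y] is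
    Hausdorff, and an open one because [q] is locally injective. *)
Lemma deck_rigid (f g : deck q) (y : Y) :
  galois_cover q -> f y = g y -> f = g.
Proof.
move=> [[_ conY] cq _] fgy; apply: deck_ext => z.
suff E : [set t | f t = g t] = setT by have : setT z by []; rewrite -E.
have cf : continuous f by apply: holomorphic_continuous; exact: deck_holo.
have cg : continuous g by apply: holomorphic_continuous; exact: deck_holo.
apply: conY; first by exists y.
  exists [set t | f t = g t]; last by rewrite setTI.
  rewrite openE => t /= fgt.
  have [U [V [s [_ [oV Vt] _ _ sV]]]] := covering_section (f t) cq.
  have nf : nbhs t (f @^-1` V) by apply: cf; exact: open_nbhs_nbhs.
  have ng : nbhs t (g @^-1` V) by apply: cg; rewrite -fgt; exact: open_nbhs_nbhs.
  rewrite /interior; apply: filterS2 nf ng => u /sV[_ fu] /sV[_ gu] /=.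
  by rewrite -fu -gu !deck_over.
exists [set t | f t = g t]; last by rewrite setTI.
move=> t clt /=; apply: (@cm_hausdorff R Y) => A B nA nB.
have {}nA : nbhs t (f @^-1` A) := cf _ _ nA.
have {}nB : nbhs t (g @^-1` B) := cg _ _ nB.
have [u [/= fgu [Au Bu]]] := clt _ (filterI nA nB).
by exists (f u); split=> //; rewrite fgu.
Qed.

End Cover.

(** * Group laws *)

Section GroupLaws.
Variables (T : Type) (S : set T) (mul : T -> T -> T) (e : T) (inv : T -> T).
Hypothesis gl : group_laws S mul e inv.

Lemma group_mulKl a b : S a -> S b -> mul (inv a) (mul a b) = b.
Proof.
move=> Sa Sb; have [[_ _ Si] mA m1 mV] := gl.
by rewrite mA ?(mV _ _).1 ?(m1 _ _).1//; exact: Si.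
Qed.

Lemma group_mulI a b c : S a -> S b -> S c -> mul a b = mul a c -> b = c.
Proof.
by move=> Sa Sb Sc bc; rewrite -(group_mulKl Sa Sb) bc group_mulKl.
Qed.

Lemma group_idempotent a : S a -> mul a a = a -> a = e.
Proof.
move=> Sa aa; have [[Se _ _] _ m1 _] := gl.
by apply: (@group_mulI a) => //; rewrite aa (m1 _ _).2.
Qed.

Lemma group_inv_unique a b : S a -> S b -> mul a b = e -> b = inv a.
Proof.
move=> Sa Sb ab; have [[_ _ Si] _ _ mV] := gl.
by apply: (@group_mulI a) => //; [exact: Si|rewrite ab (mV _ _).2].
Qed.

End GroupLaws.

Section LieGroup.
Variables (R : realType) (G : lie_group R).
Implicit Types (a b c : G) (u : lie_aut G).

Lemma lg_mulA a b c : lg_mul a (lg_mul b c) = lg_mul (lg_mul a b) c.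
Proof. by have [_ + _ _] := lg_laws G; exact. Qed.

Lemma lg_mul1g a : lg_mul (lg_one G) a = a.
Proof. by have [_ _ /(_ a)[]] := lg_laws G. Qed.

Lemma lg_mulg1 a : lg_mul a (lg_one G) = a.
Proof. by have [_ _ /(_ a)[]] := lg_laws G. Qed.

Lemma lg_mulVg a : lg_mul (lg_inv a) a = lg_one G.
Proof. by have [_ _ _ /(_ a)[]] := lg_laws G. Qed.

Lemma lg_mulgV a : lg_mul a (lg_inv a) = lg_one G.
Proof. by have [_ _ _ /(_ a)[]] := lg_laws G. Qed.

Lemma lg_mulKg a b : lg_mul (lg_inv a) (lg_mul a b) = b.
Proof. by rewrite lg_mulA lg_mulVg lg_mul1g. Qed.

Lemma lg_mulKVg a b : lg_mul a (lg_mul (lg_inv a) b) = b.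
Proof. by rewrite lg_mulA lg_mulgV lg_mul1g. Qed.

Lemma lg_mulgK a b : lg_mul (lg_mul b a) (lg_inv a) = b.
Proof. by rewrite -lg_mulA lg_mulgV lg_mulg1. Qed.

Lemma lg_inv_unique a b : lg_mul a b = lg_one G -> b = lg_inv a.
Proof. exact: (group_inv_unique (lg_laws G)). Qed.

Lemma lg_invM a b : lg_inv (lg_mul a b) = lg_mul (lg_inv b) (lg_inv a).
Proof.
by apply/esym/lg_inv_unique; rewrite -lg_mulA (lg_mulA b) lg_mulgV lg_mul1g
  lg_mulgV.
Qed.

Lemma la_one u : u (lg_one G) = lg_one G.
Proof.
by apply: (group_idempotent (lg_laws G)) => //; rewrite -la_mul lg_mul1g.
Qed.

Lemma la_invM u a : u (lg_inv a) = lg_inv (u a).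
Proof. by apply: lg_inv_unique; rewrite -la_mul lg_mulgV la_one. Qed.

Lemma la_inv_inv u a : la_inv u (lg_inv a) = lg_inv (la_inv u a).
Proof. by apply: (can_inj (la_funK u)); rewrite la_invK la_invM la_invK. Qed.

Lemma lg_mul_holomorphic_on (M : cmanifold R) (S : set M) (f g : M -> G) :
  holomorphic_on S f -> holomorphic_on S g ->
  holomorphic_on S (fun x => lg_mul (f x) (g x)).
Proof.
apply: (@holomorphic_on_comp2 _ _ _ _ _ _ setT) => //.
exact/holomorphic_holomorphic_on/lg_mul_holo.
Qed.

Lemma lg_inv_holomorphic_on (M : cmanifold R) (S : set M) (f : M -> G) :
  holomorphic_on S f -> holomorphic_on S (fun x => lg_inv (f x)).
Proof.
move=> hf; apply: (@holomorphic_on_comp _ _ _ _ _ setT f (@lg_inv R G)) => //.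
exact/holomorphic_holomorphic_on/lg_inv_holo.
Qed.

End LieGroup.

Section BundleLaws.
Variables (R : realType) (X : cmanifold R) (B : group_bundle X).
Implicit Types (x : X) (a b c : B).

Lemma gb_mul_over a b : gb_proj a = gb_proj b ->
  gb_proj (gb_mul a b) = gb_proj b.
Proof. by move=> ab; have [[_ + _] _ _ _] := gb_laws B (gb_proj b); exact. Qed.

Lemma gb_inv_over a : gb_proj (gb_inv a) = gb_proj a.
Proof. by have [[_ _ +] _ _ _] := gb_laws B (gb_proj a); exact. Qed.

Lemma gb_mulKVb a b : gb_proj a = gb_proj b ->
  gb_mul a (gb_mul (gb_inv a) b) = b.
Proof.
move=> ab; have [[_ _ Si] mA m1 mV] := gb_laws B (gb_proj b).
by rewrite mA ?(mV _ _).2 ?(m1 _ _).1//; exact: Si.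
Qed.

End BundleLaws.

(** * Trivializing the pullback of a quotient bundle *)

Section Frame.
Variables (R : realType) (X Y : cmanifold R) (q : Y -> X) (G : lie_group R).
Variable phi : deck q -> maps_aut Y G.

(** An isomorphism of group bundles from [Y * G] to the pullback of [B] which
    is equivariant for the action [tau] of the deck transformations. It says
    that [B] is the quotient of [Y * G], in a form which hides the complex
    structure of that quotient: [coord] is holomorphic although it chooses
    preimages. *)
Record frame (B : group_bundle X) := Frame {
  fr : Y -> G -> B;
  coord : Y -> B -> G;
  fr_holo : @holomorphic R (prodM Y G) B (fun yg => fr yg.1 yg.2);
  coord_holo : @holomorphic_on R (prodM Y B) G
    (fibre_product q (@gb_proj R X B)) (fun yb => coord yb.1 yb.2);
  fr_proj : forall y g, gb_proj (fr y g) = q y;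
  frM : forall y g h, fr y (lg_mul g h) = gb_mul (fr y g) (fr y h);
  fr_deck : forall (f : deck q) y g, fr (f y) (phi f y g) = fr y g;
  coordK : forall y b, q y = gb_proj b -> fr y (coord y b) = b;
  frK : forall y g, coord y (fr y g) = g }.

Section Quotient.
Variables (Q : group_bundle X) (k : prodM Y G -> Q).
Hypotheses (hq : galois_cover q) (hphi : crossed_morphism phi).
Hypothesis hk : quotient_bundle phi k.

Lemma quotient_deck (f : deck q) y g : k (f y, phi f y g) = k (y, g).
Proof. by have [_ kE _ _ _] := hk; apply/esym/kE; exists f. Qed.

Lemma quotient_fibre y b : q y = gb_proj b -> exists g, k (y, g) = b.
Proof.
have [ks _ _ kp _] := hk; have [[y' g] <-] := ks b; rewrite kp => /esym qy.
have [_ _ /(_ _ _ qy)[f fy]] := hq.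
by exists (phi f y' g); rewrite -fy quotient_deck.
Qed.

(** Two points of a fibre of [Y * G -> Y] in the same orbit are related by a
    deck transformation with a fixed point, which is the identity; and a
    crossed morphism is trivial at the identity. *)
Lemma quotient_inj y g h : k (y, g) = k (y, h) -> g = h.
Proof.
have [_ kE _ _ _] := hk; move=> /kE[f [fy <-]].
apply: (can_inj (la_funK (phi f y))).
have ff : deck_comp f f = f.
  by apply: (@deck_rigid _ _ _ _ _ _ y hq); rewrite /= fy.
by have := hphi f f y g; rewrite ff fy => /esym.
Qed.

Lemma quotient_holomorphic : holomorphic k.
Proof.
have [_ _ kl _ _] := hk => a; have [V [s [oV _ [_ _ hkV _]]]] := kl a.
by apply: holomorphic_on_cdifferentiable hkV _; exact: open_nbhs_nbhs.
Qed.

Definition quotient_coord (y : Y) (b : Q) : G :=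
  xget (lg_one G) [set g | k (y, g) = b].

Lemma quotient_coordK y b : q y = gb_proj b -> k (y, quotient_coord y b) = b.
Proof.
move=> /quotient_fibre[g kg].
by rewrite /quotient_coord; case: xgetP => // /(_ g).
Qed.

Lemma quotientK y g : quotient_coord y (k (y, g)) = g.
Proof.
have [_ _ _ kp _] := hk.
by apply: (@quotient_inj y); apply: quotient_coordK; rewrite kp.
Qed.

(** Near [(y, b)] a local inverse [s] of [k] sends [b'] to a pair [(z, g)] with
    [z] close to [y]; in the fibre product [z] lies over the image of the
    first component [y'], so [z = y'] by local injectivity of [q], and [g] is
    the coordinate. *)
Lemma quotient_coord_holo : @holomorphic_on R (prodM Y Q) G
  (fibre_product q (@gb_proj R X Q)) (fun yb => quotient_coord yb.1 yb.2).
Proof.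
have [_ cq _] := hq; have [_ _ kl kp _] := hk.
apply: holomorphic_on_local => -[y b] /= yb.
pose g := quotient_coord y b.
have [V [s [[oV Vyg] okV [sV sK hkV hs]]]] := kl (y, g).
have kg : k (y, g) = b by exact: quotient_coordK.
have sb : s b = (y, g) by rewrite -kg; have [] := sV _ Vyg.
have kVb : (k @` V) b by exists (y, g).
have [U [W [t [_ [oW Wy] _ _ tW]]]] := covering_section y cq.
have ds : cdifferentiable s b.
  by apply: holomorphic_on_cdifferentiable hs _; exact: open_nbhs_nbhs.
pose A : set Q := (k @` V) `&` (s @^-1` (W `*` setT)).
have nA : nbhs b A.
  apply: filterI; first exact: open_nbhs_nbhs.
  apply: ds.1; rewrite sb; exists (W, setT) => //; split.
    exact: open_nbhs_nbhs.
  exact: filterT.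
exists (W `*` A); first by exists (W, A) => //; split=> //; exact: open_nbhs_nbhs.
apply: (@eq_holomorphic_on _ _ _ _ (fun yb : prodM Y Q => (s yb.2).2)).
  move=> [y' b'] [/= y'b' [/= Wy' [kVb' [Wb' _]]]].
  have [Vb' ksb'] := sK _ kVb'.
  case sE : (s b') Wb' ksb' => [z h] /= Wz kz.
  suff zy : z = y' by rewrite -kz zy quotientK.
  have qz : q z = q y' by rewrite y'b' -kz kp.
  by have [_ <-] := tW _ Wz; have [_ <-] := tW _ Wy'; rewrite qz.
apply: holomorphic_on_snd.
apply: (@holomorphic_on_comp _ (prodM Y Q) Q _ _ (k @` V) snd s) => //.
  by move=> [y' b'] [_ [/= _ []]].
exact: holomorphic_on_proj2.
Qed.

Lemma quotient_frame : inhabited (frame Q).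
Proof.
have [_ _ _ kp kM] := hk.
apply: inhabits.
refine (@Frame Q (fun y g => k (y, g)) quotient_coord _ _ _ _ _ _ _) => //.
- rewrite (_ : (fun yg : prodM Y G => k (yg.1, yg.2)) = k).
    exact: quotient_holomorphic.
  by apply/funext => -[].
- exact: quotient_coord_holo.
- exact: quotient_deck.
- exact: quotient_coordK.
- exact: quotientK.
Qed.

End Quotient.

(** A frame is transported along an isomorphism of group bundles, so the bundle
    itself, and not only the quotient to which it is isomorphic, has one. *)
Lemma iso_frame (A B : group_bundle X) :
  group_bundle_iso A B -> frame B -> inhabited (frame A).
Proof.
move=> [F [F' [[FK F'K hF hF'] Fp FM]]] fB.
have F'p b : gb_proj (F' b) = gb_proj b by rewrite -Fp; have [_ ->] := F'K b I.
have fr_holoA : @holomorphic R (prodM Y G) A (fun yg => F' (fr fB yg.1 yg.2)).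
  apply: holomorphic_comp (holomorphic_on_setT hF'); exact: fr_holo.
apply: inhabits.
refine (@Frame A (fun y g => F' (fr fB y g)) (fun y a => coord fB y (F a))
  fr_holoA _ _ _ _ _ _).
- apply: (holomorphic_on_comp2 (@coord_holo _ fB)).
  + by move=> [y a] /=; rewrite /fibre_product /= Fp.
  + exact: holomorphic_on_proj1.
  + apply: (@holomorphic_on_comp _ (prodM Y A) A B _ setT snd F) => //.
    exact: holomorphic_on_proj2.
- by move=> y g; rewrite F'p fr_proj.
- move=> y g h; rewrite frM.
  have [_ {1}<-] := F'K (fr fB y g) I; have [_ {1}<-] := F'K (fr fB y h) I.
  rewrite -FM ?F'p ?fr_proj//.
  by have [] := FK (gb_mul (F' (fr fB y g)) (F' (fr fB y h))) I.
- by move=> f y g; rewrite fr_deck.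
- by move=> y b yb; rewrite coordK ?Fp//; have [] := FK b I.
- by move=> y g; have [_ ->] := F'K (fr fB y g) I; exact: frK.
Qed.

End Frame.

(** * Torsors with a section over the cover *)

Section BundleOperations.
Variables (R : realType) (X Y : cmanifold R) (q : Y -> X) (G : lie_group R).
Variables (phi : deck q -> maps_aut Y G) (B : group_bundle X).
Variable T : frame phi B.
Hypothesis cq : covering q.

Lemma fr_holomorphic_on (M : cmanifold R) (S : set M) (f : M -> Y) (g : M -> G) :
  holomorphic_on S f -> holomorphic_on S g ->
  holomorphic_on S (fun x => fr T (f x) (g x)).
Proof.
apply: (@holomorphic_on_comp2 _ _ _ _ _ _ setT) => //.
exact/holomorphic_holomorphic_on/fr_holo.
Qed.

Lemma coord_holomorphic_on (M : cmanifold R) (S : set M) (f : M -> Y)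
    (g : M -> B) :
  (forall x, S x -> q (f x) = gb_proj (g x)) ->
  holomorphic_on S f -> holomorphic_on S g ->
  holomorphic_on S (fun x => coord T (f x) (g x)).
Proof. by move=> fg; apply: (holomorphic_on_comp2 (@coord_holo _ _ _ _ _ _ _ T)). Qed.

(** The definition of a group bundle only asks for holomorphic operations on
    each fibre. That they are holomorphic in families follows from the frame:
    along a local section [s] of the cover they are the operations of [G] in
    the coordinates at the point [s x]. *)
Lemma gb_mul_holo : @holomorphic_on R (prodM B B) B
  (fibre_product (@gb_proj R X B) (@gb_proj R X B))
  (fun ab => gb_mul ab.1 ab.2).
Proof.
apply: holomorphic_on_local => -[a b] /= ab.
have [y qy] := covering_surjective cq (gb_proj a).
have [U [V [s [oU [_ Vy] sK hs sV]]]] := covering_section y cq.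
have pa : holomorphic (fun c : prodM B B => gb_proj c.1 : X).
  apply: (@holomorphic_comp R (prodM B B) B X fst); last exact: gb_proj_holo.
  by move=> ?; exact: cdifferentiable_fst.
exists [set c | U (gb_proj c.1)].
  by apply: (open_preimage_nbhs pa) => //=; rewrite -qy; have [] := sV _ Vy.
pose t (c : prodM B B) := s (gb_proj c.1).
apply: (@eq_holomorphic_on _ _ _ _
    (fun c => fr T (t c) (lg_mul (coord T (t c) c.1) (coord T (t c) c.2)))).
  move=> [a' b'] [/= a'b' Ua']; rewrite frM !coordK ?/t ?sK//.
have ht : @holomorphic_on R (prodM B B) Y
    (fibre_product (@gb_proj R X B) (@gb_proj R X B) `&`
     [set c | U (gb_proj c.1)]) t.
  apply: (@holomorphic_on_comp _ (prodM B B) X Y _ U _ s) => //.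
    by move=> c [].
  exact: holomorphic_holomorphic_on.
apply: fr_holomorphic_on => //.
apply: lg_mul_holomorphic_on; apply: coord_holomorphic_on => //.
- by move=> c _; rewrite sK.
- exact: holomorphic_on_proj1.
- by move=> c [/= cc _]; rewrite sK.
- exact: holomorphic_on_proj2.
Qed.

Lemma gb_inv_holo : holomorphic (@gb_inv R X B).
Proof.
apply: holomorphic_on_setT; apply: holomorphic_on_local => b _.
have [y qy] := covering_surjective cq (gb_proj b).
have [U [V [s [oU [_ Vy] sK hs sV]]]] := covering_section y cq.
exists (@gb_proj R X B @^-1` U).
  apply: open_preimage_nbhs => //; first exact: gb_proj_holo.
  by rewrite -qy; have [] := sV _ Vy.
pose t (c : B) := s (gb_proj c).
apply: (@eq_holomorphic_on _ _ _ _
    (fun c => fr T (t c) (lg_inv (coord T (t c) c)))).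
  move=> c _; have qt : q (t c) = gb_proj c by rewrite /t sK.
  apply: (group_inv_unique (gb_laws B (gb_proj c))) => //.
    by rewrite /fibre /= fr_proj.
  rewrite -{1}(coordK T qt) -frM lg_mulgV.
  apply: (group_idempotent (gb_laws B (gb_proj c))).
    by rewrite /fibre /= fr_proj.
  by rewrite -frM lg_mul1g.
have ht : holomorphic_on (setT `&` @gb_proj R X B @^-1` U) t.
  apply: (@holomorphic_on_comp _ B X Y _ U _ s) => //.
    by move=> c [].
  exact/holomorphic_holomorphic_on/gb_proj_holo.
apply: fr_holomorphic_on => //; apply: lg_inv_holomorphic_on.
apply: coord_holomorphic_on => //.
  by move=> c _; rewrite sK.
exact: holomorphic_on_id.
Qed.

Lemma gb_mul_holomorphic_on (M : cmanifold R) (S : set M) (f g : M -> B) :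
  (forall x, S x -> gb_proj (f x) = gb_proj (g x)) ->
  holomorphic_on S f -> holomorphic_on S g ->
  holomorphic_on S (fun x => gb_mul (f x) (g x)).
Proof. by move=> fg; exact: (holomorphic_on_comp2 gb_mul_holo). Qed.

End BundleOperations.

Section TorsorDivision.
Variables (R : realType) (X : cmanifold R) (B : group_bundle X) (P : torsor B).

Lemma to_act_holomorphic_on (M : cmanifold R) (S : set M) (f : M -> P)
    (g : M -> B) :
  (forall x, S x -> to_proj (f x) = gb_proj (g x)) ->
  holomorphic_on S f -> holomorphic_on S g ->
  holomorphic_on S (fun x => to_act (f x) (g x)).
Proof. by move=> fg; exact: (holomorphic_on_comp2 (@to_act_holo _ _ _ P)). Qed.

Lemma to_act_inj (u : P) (b c : B) :
  to_proj u = gb_proj b -> to_proj u = gb_proj c ->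
  to_act u b = to_act u c -> b = c.
Proof.
move=> ub uc.
have [U [F [F' [[oU Uu] [FK F'K _ _] Fp FM]]]] :=
  to_locally_trivial P (to_proj u).
have [/= U' F'u] := F'K u Uu; have F'p := Fp _ U'; rewrite F'u in F'p.
have F'M d : to_proj u = gb_proj d -> F' (to_act u d) = gb_mul (F' u) d.
  move=> ud; rewrite -{1}F'u -FM ?F'u -?F'p//.
  by have [|_ ->//] := FK (gb_mul (F' u) d); rewrite /= gb_mul_over -?F'p// -ud.
move=> bc; apply: (group_mulI (gb_laws B (to_proj u))) (F' u) _ _ _ _ _ _ => //.
by rewrite -!F'M ?bc.
Qed.

(** The division [u^-1 v] of two points of a fibre of the torsor. *)
Definition tdiv (u v : P) : B :=
  xget (gb_one B (to_proj u)) [set b | gb_proj b = to_proj u /\ to_act u b = v].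

(** In a local trivialization, where the torsor is [B] acting on itself, the
    division is that of the group bundle; this gives its existence and, below,
    its holomorphy. *)
Lemma local_division (U : set X) (F : B -> P) (F' : P -> B) (u v : P) :
  biholomorphic_on F F' (@gb_proj R X B @^-1` U) (@to_proj R X B P @^-1` U) ->
  (forall a, U (gb_proj a) -> to_proj (F a) = gb_proj a) ->
  (forall a b, U (gb_proj a) -> gb_proj a = gb_proj b ->
     F (gb_mul a b) = to_act (F a) b) ->
  U (to_proj u) -> to_proj u = to_proj v ->
  [/\ gb_proj (F' u) = to_proj u, gb_proj (F' v) = to_proj u &
      to_act u (gb_mul (gb_inv (F' u)) (F' v)) = v].
Proof.
move=> [FK F'K _ _] Fp FM Uu uv.
have F'p w : U (to_proj w) -> gb_proj (F' w) = to_proj w.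
  by move=> /F'K[/= Uw Fw]; rewrite -Fp// Fw.
have Fu := F'p _ Uu; have Fv := F'p v; rewrite -uv in Fv; have {}Fv := Fv Uu.
split=> //; have [_ {1}<-] := F'K u Uu.
rewrite -FM ?Fu// ?gb_mul_over ?gb_inv_over ?Fu ?Fv// gb_mulKVb ?Fu ?Fv//.
by have [] := F'K v; rewrite /= -?uv.
Qed.

Lemma tdivP (u v : P) : to_proj u = to_proj v ->
  gb_proj (tdiv u v) = to_proj u /\ to_act u (tdiv u v) = v.
Proof.
move=> uv; have [U [F [F' [[oU Uu] bF Fp FM]]]] :=
  to_locally_trivial P (to_proj u).
have [F'u F'v uE] := local_division bF Fp FM Uu uv.
rewrite /tdiv; case: xgetP => [b _ //|/(_ (gb_mul (gb_inv (F' u)) (F' v)))].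
by case; split=> //; rewrite gb_mul_over ?gb_inv_over ?F'v.
Qed.

Lemma tdiv_unique (u v : P) (b : B) :
  to_proj u = gb_proj b -> to_act u b = v -> tdiv u v = b.
Proof.
move=> ub <-; have uv := to_act_over ub.
have [tp tE] := tdivP (esym uv).
by apply: (@to_act_inj u); rewrite ?tp ?tE.
Qed.

Lemma tdiv_over (u v : P) : to_proj u = to_proj v ->
  gb_proj (tdiv u v) = to_proj u.
Proof. by move=> /tdivP[]. Qed.

Lemma tdivK (u v : P) : to_proj u = to_proj v -> to_act u (tdiv u v) = v.
Proof. by move=> /tdivP[]. Qed.

Lemma tdiv_mul (u v : P) (b : B) : to_proj u = to_proj v ->
  to_proj v = gb_proj b -> tdiv u (to_act v b) = gb_mul (tdiv u v) b.
Proof.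
move=> uv vb; apply: tdiv_unique; first by rewrite gb_mul_over ?tdiv_over ?uv.
by rewrite to_act_mul ?tdivK ?tdiv_over// uv.
Qed.

End TorsorDivision.

Section Sections.
Variables (R : realType) (X Y : cmanifold R) (q : Y -> X) (G : lie_group R).
Variables (phi : deck q -> maps_aut Y G) (B : group_bundle X).
Variable T : frame phi B.
Hypothesis cq : covering q.
Implicit Types P Q : torsor B.

Lemma tdiv_holo P : @holomorphic_on R (prodM P P) B
  (fibre_product (@to_proj R X B P) (@to_proj R X B P))
  (fun uv => tdiv uv.1 uv.2).
Proof.
apply: holomorphic_on_local => -[u v] /= uv.
have [U [F [F' [[oU Uu] bF Fp FM]]]] :=
  to_locally_trivial P (to_proj u).
have pu : holomorphic (fun c : prodM P P => to_proj c.1 : X).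
  apply: (@holomorphic_comp R (prodM P P) P X fst); last exact: to_proj_holo.
  by move=> ?; exact: cdifferentiable_fst.
exists [set c | U (to_proj c.1)]; first exact: (open_preimage_nbhs pu).
set S := _ `&` _.
have SE (c : prodM P P) : S c ->
    [/\ gb_proj (F' c.1) = to_proj c.1, gb_proj (F' c.2) = to_proj c.1 &
      to_act c.1 (gb_mul (gb_inv (F' c.1)) (F' c.2)) = c.2].
  by move=> [cc Uc]; exact: (local_division bF Fp FM).
apply: (@eq_holomorphic_on _ _ _ _
    (fun c : prodM P P => gb_mul (gb_inv (F' c.1)) (F' c.2))).
  move=> c /SE[F1 F2 cE]; apply/esym/tdiv_unique => //.
  by rewrite gb_mul_over ?gb_inv_over ?F1 ?F2.
have [_ _ _ hF'] := bF.
have h1 : @holomorphic_on R (prodM P P) B S (fun c => F' c.1).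
  apply: (@holomorphic_on_comp _ (prodM P P) P B _
    (@to_proj R X B P @^-1` U) fst F') => //; last exact: holomorphic_on_proj1.
  by move=> c [].
have h2 : @holomorphic_on R (prodM P P) B S (fun c => F' c.2).
  apply: (@holomorphic_on_comp _ (prodM P P) P B _
    (@to_proj R X B P @^-1` U) snd F') => //; last exact: holomorphic_on_proj2.
  by move=> c [cc Uc] /=; rewrite -cc.
apply: (gb_mul_holomorphic_on T cq) => //.
  by move=> c /SE[F1 F2 _]; rewrite gb_inv_over F1 F2.
apply: (@holomorphic_on_comp _ (prodM P P) B B _ setT _ (@gb_inv R X B)) => //.
exact/holomorphic_holomorphic_on/(gb_inv_holo T).
Qed.

Lemma tdiv_holomorphic_on P (M : cmanifold R) (S : set M) (f g : M -> P) :
  (forall x, S x -> to_proj (f x) = to_proj (g x)) ->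
  holomorphic_on S f -> holomorphic_on S g ->
  holomorphic_on S (fun x => tdiv (f x) (g x)).
Proof. by move=> fg; exact: (holomorphic_on_comp2 (@tdiv_holo P)). Qed.

End Sections.

(** * Torsors and cocycles *)

Section Cocycles.
Variables (R : realType) (X Y : cmanifold R) (q : Y -> X) (G : lie_group R).
Variables (phi : deck q -> maps_aut Y G) (B : group_bundle X).
Variable T : frame phi B.
Hypothesis hq : galois_cover q.
Implicit Types P Q : torsor B.

Let cq : covering q. Proof. by case: hq. Qed.

(** The action of [G] on the pullback of [P] to [Y], at a point [(y, u)]. *)
Definition ract P (u : P) (y : Y) (g : G) : P := to_act u (fr T y g).

Lemma ract_over P (u : P) y g :
  to_proj u = q y -> to_proj (ract u y g) = q y.
Proof. by move=> uy; rewrite to_act_over ?fr_proj. Qed.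

Lemma ractM P (u : P) y g h : to_proj u = q y ->
  ract u y (lg_mul g h) = ract (ract u y g) y h.
Proof. by move=> uy; rewrite /ract frM to_act_mul ?fr_proj. Qed.

Lemma ract_inj P (u : P) y g h :
  to_proj u = q y -> ract u y g = ract u y h -> g = h.
Proof.
move=> uy /to_act_inj; rewrite !fr_proj => /(_ uy uy) gh.
by rewrite -(frK T y g) gh frK.
Qed.

Lemma ract_coord P (u v : P) y : to_proj u = q y -> to_proj v = q y ->
  ract u y (coord T y (tdiv u v)) = v.
Proof.
by move=> uy vy; rewrite /ract coordK ?tdivK ?tdiv_over ?uy ?vy.
Qed.

Lemma ract_deckV P (u : P) (f : deck q) y g :
  ract u y (la_inv (phi f y) g) = ract u (f y) g.
Proof. by rewrite /ract -(fr_deck T f) la_invK. Qed.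

Lemma ract_holomorphic_on P (M : cmanifold R) (S : set M) (f : M -> P)
    (y : M -> Y) (g : M -> G) :
  (forall x, S x -> to_proj (f x) = q (y x)) ->
  holomorphic_on S f -> holomorphic_on S y -> holomorphic_on S g ->
  holomorphic_on S (fun x => ract (f x) (y x) (g x)).
Proof.
move=> fy hf hy hg; apply: to_act_holomorphic_on => //.
  by move=> x Sx; rewrite fr_proj fy.
exact: fr_holomorphic_on.
Qed.

(** Such an [s] is the same as a section of the pullback of [P] to [Y]. *)
Definition lifts_cover P (s : Y -> P) :=
  holomorphic s /\ forall y, to_proj (s y) = q y.

(** The cocycle measures how far [s] is from being invariant under the deck
    transformations, that is, from descending to a section of [P]. *)
Definition section_cocycle P (s : Y -> P) (rho : deck q -> maps Y G) :=
  forall (f : deck q) y, ract (s (f y)) y (rho f y) = s y.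

Definition has_cocycle P (rho : cocycle phi) :=
  exists2 s : Y -> P, lifts_cover s & section_cocycle s rho.

(** Two trivializations of the pullback of [P] differ by a function on [Y],
    namely the coordinate of the division of one section by the other. *)
Lemma section_difference P (s s' : Y -> P) :
  lifts_cover s -> lifts_cover s' ->
  exists mu : maps Y G, forall y, ract (s' y) y (mu y) = s y.
Proof.
move=> [hs sq] [hs' s'q].
have hmu : holomorphic (fun y => coord T y (tdiv (s' y) (s y))).
  apply: holomorphic_on_setT; apply: coord_holomorphic_on.
  - by move=> y _; rewrite tdiv_over ?sq ?s'q.
  - exact: holomorphic_on_id.
  - apply: (tdiv_holomorphic_on T cq); try exact: holomorphic_holomorphic_on.
    by move=> y _; rewrite sq s'q.
by exists (Maps hmu) => y; apply: ract_coord.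
Qed.

Lemma lifts_cover_deck P (s : Y -> P) (f : deck q) :
  lifts_cover s -> lifts_cover (s \o f).
Proof.
move=> [hs sq]; split=> [|y]; last by rewrite /= sq deck_over.
exact: holomorphic_comp (deck_holo f) hs.
Qed.

(** [s] and [s \o f] are both sections of the pullback; the cocycle relation
    compares [s], [s \o f2] and [s \o f1 \o f2], and holds because the action of
    [G] at a point is free. *)
Lemma lifts_cover_cocycle P (s : Y -> P) :
  lifts_cover s -> exists rho : cocycle phi, section_cocycle s rho.
Proof.
move=> ls; have [hs sq] := ls.
have [rho rhoE] :=
  choice (fun f => section_difference ls (lifts_cover_deck f ls)).
have rhoM (f1 f2 : deck q) (y : Y) : rho (deck_comp f1 f2) y =
    lg_mul (maps_act phi (rho f1) f2 y) (rho f2 y).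
  apply: (@ract_inj _ (s (f1 (f2 y))) y); first by rewrite sq !deck_over.
  rewrite ractM ?sq ?deck_over// ract_deckV.
  have /= -> := rhoE f1 (f2 y); have /= -> := rhoE f2 y.
  by have /= -> := rhoE (deck_comp f1 f2) y.
by exists (Cocycle rhoM).
Qed.

Lemma has_cocycle_cohomologous P (rho rho' : cocycle phi) :
  has_cocycle P rho -> has_cocycle P rho' -> cohomologous rho rho'.
Proof.
move=> [s ls sE] [s' ls' s'E]; have [mu muE] := section_difference ls ls'.
exists mu => f y; suff <- : lg_mul (rho' f y) (mu y) =
    lg_mul (maps_act phi mu f y) (rho f y) by rewrite lg_mulgK.
have s'q : to_proj (s' (f y)) = q y by rewrite ls'.2 deck_over.
apply: (@ract_inj _ (s' (f y)) y) => //.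
by rewrite !ractM// ract_deckV muE sE s'E muE.
Qed.

(** Translating the section by the inverse of [mu] changes its cocycle into
    that of [mu] acting on it. *)
Lemma cohomologous_has_cocycle P (rho rho' : cocycle phi) :
  cohomologous rho rho' -> has_cocycle P rho -> has_cocycle P rho'.
Proof.
move=> [mu muE] [s [hs sq] sE].
exists (fun y => ract (s y) y (lg_inv (mu y))).
  split=> [|y]; last exact: ract_over.
  apply: holomorphic_on_setT; apply: ract_holomorphic_on => //.
  - exact: holomorphic_holomorphic_on.
  - exact: holomorphic_on_id.
  - exact/lg_inv_holomorphic_on/holomorphic_holomorphic_on/maps_holo.
move=> f y; have sfy : to_proj (s (f y)) = q y by rewrite sq deck_over.
rewrite -(ract_deckV _ f) -ractM// muE la_inv_inv.
by rewrite -lg_mulA lg_mulKg ractM// sE.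
Qed.

Lemma iso_has_cocycle P Q (rho : cocycle phi) :
  torsor_iso P Q -> has_cocycle P rho -> has_cocycle Q rho.
Proof.
move=> [F [_ [[hF Fp FM] _ _ _]]] [s [hs sq] sE]; exists (F \o s).
  by split=> [|y]; [exact: holomorphic_comp hF | rewrite /= Fp].
move=> f y; rewrite /= /ract -FM ?fr_proj ?sq ?deck_over//.
by congr F; exact: sE.
Qed.

(** The map [s y . b |-> s' y . b] of the fibres over [q y], computed at the
    representative [y] chosen by [r]. *)
Definition transfer P Q (r : X -> Y) (s : Y -> P) (s' : Y -> Q) (u : P) : Q :=
  to_act (s' (r (to_proj u))) (tdiv (s (r (to_proj u))) u).

Section Transfer.
Variables (P Q : torsor B) (s : Y -> P) (s' : Y -> Q) (rho : cocycle phi).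
Hypotheses (ls : lifts_cover s) (ls' : lifts_cover s').
Hypotheses (sE : section_cocycle s rho) (s'E : section_cocycle s' rho).
Variable r : X -> Y.
Hypothesis rK : forall x, q (r x) = x.

(** Equal cocycles make the transport independent of the point of the fibre. *)
Lemma transferE y u : q y = to_proj u ->
  transfer r s s' u = to_act (s' y) (tdiv (s y) u).
Proof.
move=> yu; have [hs sq] := ls; have [hs' s'q] := ls'.
have [f fy] : exists f : deck q, f (r (to_proj u)) = y.
  by have [_ _] := hq; apply; rewrite rK.
rewrite /transfer; move: (r (to_proj u)) (rK (to_proj u)) fy => z zu fz.
have fzq : q (f z) = q z by rewrite deck_over.
have -> : tdiv (s y) u = gb_mul (fr T z (rho f z)) (tdiv (s z) u).
  apply: tdiv_unique.
    by rewrite gb_mul_over ?fr_proj ?tdiv_over ?sq// yu zu.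
  rewrite to_act_mul ?fr_proj ?tdiv_over ?sq ?zu -?fz ?fzq//.
  by have := sE f z; rewrite /ract => ->; rewrite tdivK ?sq.
rewrite to_act_mul ?fr_proj ?tdiv_over ?sq ?s'q ?zu -?fz ?fzq//.
by have := s'E f z; rewrite /ract => ->.
Qed.

Lemma transfer_morphism : torsor_morphism (transfer r s s').
Proof.
have [hs sq] := ls; have [hs' s'q] := ls'.
have tp u : to_proj (transfer r s s' u) = to_proj u.
  by rewrite to_act_over ?tdiv_over ?sq ?s'q ?rK.
split=> // [|u b ub]; last first.
  rewrite /transfer to_act_over// tdiv_mul ?sq ?rK//.
  by rewrite to_act_mul ?tdiv_over ?sq ?s'q ?rK.
apply: holomorphic_on_setT; apply: holomorphic_on_local => u _.
have [U [V [t [oU [_ Vy] tK ht tV]]]] := covering_section (r (to_proj u)) cq.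
exists (@to_proj R X B P @^-1` U).
  apply: open_preimage_nbhs => //; first exact: to_proj_holo.
  by rewrite -(rK (to_proj u)); have [] := tV _ Vy.
apply: (@eq_holomorphic_on _ _ _ _
    (fun v => to_act (s' (t (to_proj v))) (tdiv (s (t (to_proj v))) v))).
  by move=> v _; rewrite -(@transferE (t (to_proj v))).
have htp : holomorphic_on (setT `&` @to_proj R X B P @^-1` U)
    (fun v => t (to_proj v)).
  apply: (@holomorphic_on_comp _ P X Y _ U _ t) => //; first by move=> v [].
  exact/holomorphic_holomorphic_on/to_proj_holo.
apply: to_act_holomorphic_on.
- by move=> v _; rewrite tdiv_over ?sq ?s'q ?tK.
- apply: (@holomorphic_on_comp _ P Y Q _ setT _ s') => //.
  exact: holomorphic_holomorphic_on.
- apply: (tdiv_holomorphic_on T cq); first by move=> v _; rewrite sq tK.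
    apply: (@holomorphic_on_comp _ P Y P _ setT _ s) => //.
    exact: holomorphic_holomorphic_on.
  exact: holomorphic_on_id.
Qed.

End Transfer.

Lemma transferK P Q (r : X -> Y) (s : Y -> P) (s' : Y -> Q) :
  (forall x, q (r x) = x) -> lifts_cover s -> lifts_cover s' ->
  cancel (transfer r s s') (transfer r s' s).
Proof.
move=> rK [_ sq] [_ s'q] u.
have sr : to_proj (s (r (to_proj u))) = to_proj u by rewrite sq rK.
rewrite {1}/transfer to_act_over ?tdiv_over ?sq ?s'q ?rK//.
rewrite {1}/transfer.
rewrite (@tdiv_unique _ _ _ _ _ _ (tdiv (s (r (to_proj u))) u)) ?tdivK//.
by rewrite tdiv_over// s'q sq.
Qed.

Lemma has_cocycle_iso P Q (rho : cocycle phi) :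
  has_cocycle P rho -> has_cocycle Q rho -> torsor_iso P Q.
Proof.
move=> [s ls sE] [s' ls' s'E]; have [r rK] := choice (covering_surjective cq).
exists (transfer r s s'), (transfer r s' s); split.
- exact: (transfer_morphism ls ls' sE s'E rK).
- exact: (transfer_morphism ls' ls s'E sE rK).
- exact: transferK.
- exact: transferK.
Qed.

End Cocycles.

Section Trivial.
Variables (R : realType) (X Y : cmanifold R) (q : Y -> X) (G : lie_group R).
Variables (phi : deck q -> maps_aut Y G) (B : pi_group_bundle q G).
Variable T : frame phi B.
Hypothesis cq : covering q.

Lemma trivial_pullback_section (P : torsor B) :
  trivial_pullback P -> exists s : Y -> P, lifts_cover q s.
Proof.
move=> [F [F' [[FS _ hF _] F1 _]]].
exists (fun y => (F (y, lg_one G)).2); split.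
  apply: holomorphic_on_setT; apply: holomorphic_on_snd.
  apply: (@holomorphic_on_comp _ Y (prodM Y G) (prodM Y P) _ setT _ F) => //.
  apply: holomorphic_on_pair; first exact: holomorphic_on_id.
  exact: holomorphic_on_cst.
move=> y; have [+ _] := FS (y, lg_one G) I.
by rewrite /fibre_product /= F1.
Qed.

(** A trivialization of the pullback is the orbit map of a section. Together
    with the previous lemma, this makes triviality independent of the chosen
    isomorphism [pg_iso] between the pullback of [B] and [Y * G], which need not
    be the one given by the frame [T]. *)
Lemma section_trivial_pullback (P : torsor B) (s : Y -> P) :
  lifts_cover q s -> trivial_pullback P.
Proof.
move=> [hs sq]; have [iS isoK hi hi'] := @pg_iso_biholo _ _ _ _ _ B.
have ip y g : gb_proj (pg_iso B (y, g)).2 = q y.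
  by have [+ _] := iS (y, g) I; rewrite /fibre_product /= pg_iso_over.
exists (fun yg => (yg.1, to_act (s yg.1) (pg_iso B yg).2)),
  (fun yu => (yu.1, (@pg_iso_inv _ _ _ _ _ B (yu.1, tdiv (s yu.1) yu.2)).2)).
have dp y u : q y = to_proj u -> q y = gb_proj (tdiv (s y) u).
  by move=> yu; rewrite tdiv_over sq.
have isoE y b : q y = gb_proj b ->
    pg_iso B (y, (@pg_iso_inv _ _ _ _ _ B (y, b)).2) = (y, b).
  move=> yb; have [_ iK] := isoK (y, b) yb.
  move: (pg_iso_inv _) iK => [z g] zg.
  by have := pg_iso_over B z g; rewrite zg /= => {1}->.
split=> //; last first.
  by move=> y g h; rewrite /= pg_iso_mul to_act_mul ?ip ?sq.
split.
- move=> [y g] _; split; first by rewrite /fibre_product /= to_act_over ?ip ?sq.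
  rewrite /= (@tdiv_unique _ _ _ _ _ _ (pg_iso B (y, g)).2) ?ip ?sq//.
  have [_] := iS (y, g) I.
  by case: (pg_iso B (y, g)) (pg_iso_over B y g) => z b /= -> ->.
- move=> [y u] yu; split=> //=; congr (_, _).
  by rewrite isoE /=; [rewrite tdivK ?sq | exact: dp].
- apply: holomorphic_on_pair; first exact: holomorphic_on_proj1.
  apply: to_act_holomorphic_on.
  + by move=> [y g] _; rewrite ip sq.
  + apply: (@holomorphic_on_comp _ (prodM Y G) Y P _ setT _ s) => //.
      exact: holomorphic_on_proj1.
    exact: holomorphic_holomorphic_on.
  + by apply: holomorphic_on_snd.
- apply: holomorphic_on_pair; first exact: holomorphic_on_proj1.
  apply: holomorphic_on_snd.
  apply: (@holomorphic_on_comp _ (prodM Y P) (prodM Y B) (prodM Y G) _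
    (fibre_product q (@gb_proj R X B)) _ (@pg_iso_inv _ _ _ _ _ B)) => //.
    by move=> [y u] yu; exact: dp.
  apply: holomorphic_on_pair; first exact: holomorphic_on_proj1.
  apply: (tdiv_holomorphic_on T cq).
  + by move=> [y u] yu; rewrite sq.
  + apply: (@holomorphic_on_comp _ (prodM Y P) Y P _ setT _ s) => //.
      exact: holomorphic_on_proj1.
    exact: holomorphic_holomorphic_on.
  + exact: holomorphic_on_proj2.
Qed.

End Trivial.

(** * Changing the complex structure of a manifold over a base *)

(** A copy of [T], so that a type which already has a topology can be given
    another one. *)
Definition retopologized (T : choiceType) (op : set_system T) (opT : op setT)
    (opI : setI_closed op) (op_bigU : forall (J : Type) (A : J -> set T),
      (forall j, op (A j)) -> op (\bigcup_j A j)) : Type := T.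

Section Retopologized.
Variables (T : choiceType) (op : set_system T).
Hypotheses (opT : op setT) (opI : setI_closed op).
Hypothesis op_bigU : forall (J : Type) (A : J -> set T),
  (forall j, op (A j)) -> op (\bigcup_j A j).
Let T' := retopologized opT opI op_bigU.

HB.instance Definition _ := Choice.copy T' T.
HB.instance Definition _ := isOpenTopological.Build T' opT opI op_bigU.

Lemma retopologizedE : @open T' = op.
Proof. by []. Qed.

End Retopologized.

(** Let [M] lie over [X], and let [th i] be bijections of [M] over [X], indexed
    by an open cover [U i] of [X], such that [th j^-1 \o th i] is holomorphic
    over [U i `&` U j]. Then [M] has a second complex structure, for which each
    [th i] is biholomorphic over [U i] from the first one to the second one.
    This is gluing with the glued set known in advance. *)
Section Glue.
Variables (R : realType) (M X : cmanifold R) (p : M -> X).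
Variables (I : Type) (U : I -> set X) (th th' : I -> M -> M).
Hypothesis hp : holomorphic p.
Hypothesis oU : forall i, open (U i).
Hypothesis coverU : forall x, exists i, U i x.
Hypothesis thK : forall i, cancel (th i) (th' i).
Hypothesis th'K : forall i, cancel (th' i) (th i).
Hypothesis thp : forall i a, p (th i a) = p a.
Hypothesis th_trans : forall i j a, U i (p a) -> U j (p a) ->
  cdifferentiable (th' j \o th i) a.

Let th'p i a : p (th' i a) = p a. Proof. by rewrite -{2}(th'K i a) thp. Qed.

Let open_over i : open (p @^-1` U i).
Proof. by apply: open_comp (oU i) => a _; exact: holomorphic_continuous. Qed.

Let glue_open : set_system M :=
  [set A | forall i, open (th i @^-1` A `&` p @^-1` U i)].

Fact glue_openT : glue_open setT.
Proof. by move=> i; rewrite preimage_setT setTI. Qed.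

Fact glue_openI : setI_closed glue_open.
Proof.
move=> A A' oA oA' i; rewrite preimage_setI -(setIid (_ @^-1` U i)) setIACA.
by exact: openI.
Qed.

Fact glue_open_bigU J (A : J -> set M) :
  (forall j, glue_open (A j)) -> glue_open (\bigcup_j A j).
Proof.
move=> oA i; rewrite preimage_bigcup setI_bigcupl.
by apply: bigcup_open => j _; exact: oA.
Qed.

Definition glue_space : topologicalType :=
  retopologized glue_openT glue_openI glue_open_bigU.

Lemma glue_openE : @open glue_space = glue_open.
Proof. exact: retopologizedE. Qed.

Lemma glue_nbhs i (a : M) (A : set M) : U i (p a) ->
  @nbhs _ glue_space a A <-> nbhs (th' i a) (th i @^-1` A).
Proof.
move=> Ua; split.
  rewrite nbhsE => -[O [oO Oa] OA]; rewrite glue_openE in oO; have oi := oO i.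
  apply: filterS (open_nbhs_nbhs (conj oi _)); last first.
    by split; rewrite /= ?th'K// th'p.
  by move=> z [/OA].
move=> nA; rewrite nbhsE.
have : nbhs (th' i a) ((th i @^-1` A) `&` p @^-1` U i).
  by apply: filterI => //; apply: open_nbhs_nbhs; split; rewrite //= th'p.
rewrite nbhsE => -[W [oW Wa] WA].
exists (th' i @^-1` W); last by move=> b /WA[/=]; rewrite th'K.
split=> //; rewrite glue_openE => j; rewrite openE => b [/= Wb Ujb].
have Uib : U i (p b) by have [_ /=] := WA _ Wb; rewrite th'p thp.
have nW : nbhs b ((th' i \o th j) @^-1` W).
  by apply: (th_trans Ujb Uib).1; exact: open_nbhs_nbhs.
by apply: filterI => //; exact: open_nbhs_nbhs.
Qed.

Lemma glue_open_over i : @open glue_space (p @^-1` U i).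
Proof.
rewrite glue_openE => j; rewrite (_ : th j @^-1` _ = p @^-1` U i).
  by apply: openI.
by apply/seteqP; split=> a /=; rewrite thp.
Qed.

(** Points over different points of [X] are separated by [p], which is still
    continuous; points of the same fibre lie in one piece over some [U i]. *)
Lemma glue_hausdorff : hausdorff_space glue_space.
Proof.
move=> a b ab; have pab : p a = p b.
  apply: (@cm_hausdorff R X) => A A' nA nA'.
  have glue_nbhs_over (c : M) (C : set X) : nbhs (p c) C ->
      @nbhs _ glue_space c (p @^-1` C).
    move=> nC; have [i Ui] := coverU (p c); apply/(glue_nbhs _ Ui).
    have := holomorphic_continuous hp; rewrite -(th'p i c) in nC => /(_ _ _ nC).
    by rewrite nbhs_filterE /=; apply: filterS => z /=; rewrite thp.
  have [z [/= Az A'z]] :=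
    ab _ _ (glue_nbhs_over _ _ nA) (glue_nbhs_over _ _ nA').
  by exists (p z).
have [i Ua] := coverU (p a); have Ub := Ua; rewrite pab in Ub.
apply: (can_inj (th'K i)); apply: (@cm_hausdorff R M) => A A' nA nA'.
have nbhs_th (c : M) (C : set M) : U i (p c) -> nbhs (th' i c) C ->
    @nbhs _ glue_space c (th' i @^-1` C).
  move=> Uc nC; apply/(glue_nbhs _ Uc).
  by apply: filterS nC => z /=; rewrite thK.
have [z [/= Az A'z]] := ab _ _ (nbhs_th _ _ Ua nA) (nbhs_th _ _ Ub nA').
by exists (th' i z).
Qed.

(** The pieces over the members of a countable basis of [X] which are contained
    in some [U i] carry the countable bases transported from [M]. *)
Lemma glue_second_countable : @second_countable glue_space.
Proof.
have [C cC [oC nC]] := cm_second_countable X.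
have [D cD [oD nD]] := cm_second_countable M.
have /choice[h hE] : forall c : set X, exists o : option I,
    if o is Some i then c `<=` U i else ~ exists i, c `<=` U i.
  move=> c; have [[i ci]|nc] := pselect (exists i, c `<=` U i).
    by exists (Some i).
  by exists None.
pose piece (cd : set X * set M) : set M :=
  if h cd.1 is Some i then p @^-1` cd.1 `&` th' i @^-1` cd.2 else set0.
exists (piece @` (C `*` D)).
  exact/(sub_countable (card_image_le _ _))/countableX.
split=> [_ [[c d] [/= Cc Dd] <-]|a A nA].
  rewrite /piece /=; have := hE c; case: (h c) => [i ci|_]; last exact: open0.
  rewrite openE => a [/= ca da]; rewrite /interior.
  apply/(glue_nbhs _ (ci _ ca)); rewrite preimage_setI; apply: filterI.
    apply: filterS (_ : nbhs (th' i a) (p @^-1` c)).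
      by move=> z /=; rewrite thp.
    apply: (holomorphic_continuous hp); apply: open_nbhs_nbhs.
    by split; [exact: oC | rewrite th'p].
  apply: filterS (_ : nbhs (th' i a) d); first by move=> z /=; rewrite thK.
  by apply: open_nbhs_nbhs; split => //; exact: oD.
have [i0 Ua] := coverU (p a).
have [c [Cc ca] ci0] := nC _ _ (open_nbhs_nbhs (conj (oU i0) Ua)).
have := hE c; case hc : (h c) => [i|] ci; last by case: ci; exists i0.
have /(glue_nbhs _ (ci _ ca)) /nD[d [Dd da] dA] := nA.
exists (piece (c, d)); first by split; [exists (c, d) | rewrite /piece /= hc].
by rewrite /piece /= hc => z [_ /dA] /=; rewrite th'K.
Qed.

Section GlueChart.
Variables (i : I) (c : chart R M).

Let dom : set M := th' i @^-1` cdom c `&` p @^-1` U i.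
Let map : M -> 'rV[CC R]_(cdim c) := cmap c \o th' i.
Let inv : 'rV[CC R]_(cdim c) -> M := th i \o cinv c.

Fact glue_cdom_open : @open glue_space dom.
Proof.
rewrite openE => a [/= ca Ua]; rewrite /interior.
apply/(glue_nbhs _ Ua); rewrite preimage_setI; apply: filterI.
  apply: filterS (open_nbhs_nbhs (conj (cdom_open c) ca)) => z /=.
  by rewrite thK.
apply: filterS (_ : nbhs (th' i a) (p @^-1` U i)).
  by move=> z /=; rewrite thp.
by apply: open_nbhs_nbhs; split; rewrite //= th'p.
Qed.

Fact glue_cimg_open : open (map @` dom).
Proof.
rewrite openE => _ [a [/= ca Ua] <-]; rewrite /interior /map /=.
have cc := cinv_cont ca; rewrite /prop_for /continuous_at cmapK // in cc.
have nU : nbhs (cmap c (th' i a)) (cinv c @^-1` (p @^-1` U i)).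
  by apply: cc; apply: open_nbhs_nbhs; split; rewrite //= th'p.
have nc : nbhs (cmap c (th' i a)) (cmap c @` cdom c).
  by apply: open_nbhs_nbhs; split; [exact: cimg_open | exists (th' i a)].
apply: filterS2 nU nc => _ /[swap] -[b cb <-] /=; rewrite cmapK// => Ub.
by exists (th i b); rewrite /map /dom /= ?thK ?thp.
Qed.

Fact glue_cmapK a : dom a -> inv (map a) = a.
Proof. by move=> [/= ca _]; rewrite /inv /map /= cmapK// th'K. Qed.

Fact glue_cmap_cont a : dom a -> {for a, continuous (map : glue_space -> _)}.
Proof.
move=> [/= ca Ua] A nA; apply/(glue_nbhs _ Ua).
have := cmap_cont ca nA; rewrite nbhs_filterE /=.
by apply: filterS => z /=; rewrite /map /= thK.
Qed.

Fact glue_cinv_cont a : dom a -> {for map a, continuous (inv : _ -> glue_space)}.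
Proof.
move=> [/= ca Ua] A; rewrite /inv /map /= cmapK// th'K => /(glue_nbhs _ Ua) nA.
have := cinv_cont ca; rewrite /prop_for /continuous_at cmapK// => /(_ _ nA).
exact.
Qed.

Definition glue_chart : chart R glue_space :=
  Chart glue_cdom_open glue_cimg_open glue_cmapK glue_cmap_cont glue_cinv_cont.

End GlueChart.

Let glue_atlas : set (chart R glue_space) :=
  [set c | exists i d, @atlas R M d /\ c = glue_chart i d].

Fact glue_atlas_cover (a : glue_space) : exists2 c, glue_atlas c & cdom c a.
Proof.
have [i Ua] := coverU (p a); have [d Ad da] := atlas_cover (th' i a).
by exists (glue_chart i d) => //; exists i, d.
Qed.

Fact glue_atlas_compatible c d : glue_atlas c -> glue_atlas d -> compatible c d.
Proof.
have half i j (c' d' : chart R M) a : atlas c' -> atlas d' ->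
    cdom c' (th' i a) -> cdom d' (th' j a) -> U i (p a) -> U j (p a) ->
    differentiable (cmap (glue_chart j d') \o cinv (glue_chart i c'))
      (cmap (glue_chart i c') a).
  move=> Ac Ad ca da Uia Uja.
  have Ui' : U i (p (th' i a)) by rewrite th'p.
  have Uj' : U j (p (th' i a)) by rewrite th'p.
  by apply: (th_trans Ui' Uj').2 => //=; rewrite th'K.
move=> [i [c' [Ac ->]]] [j [d' [Ad ->]]] a [/= ca Uia] [/= da Uja].
by split; exact: half.
Qed.

Definition glueM : cmanifold R := @CManifold R glue_space glue_hausdorff
  glue_second_countable glue_atlas glue_atlas_cover glue_atlas_compatible.

Lemma glue_cdifferentiable i (a : M) :
  U i (p a) -> @cdifferentiable R M glueM (th i) a.
Proof.
move=> Ua; have Uta : U i (p (th i a)) by rewrite thp.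
split=> [A /(glue_nbhs _ Uta)|c _ Ac [j [d [Ad ->]]] ca [/= da Uja]].
  by rewrite thK.
by rewrite thp in Uja; exact: (th_trans Ua Uja).2.
Qed.

Lemma glue_inv_cdifferentiable i (a : M) :
  U i (p a) -> @cdifferentiable R glueM M (th' i) a.
Proof.
move=> Ua; split=> [A nA|_ d [j [c [Ac ->]]] Ad [/= ca Uja] da].
  rewrite nbhs_filterE /=; apply/(glue_nbhs _ Ua); apply: filterS nA => z /=.
  by rewrite thK.
have Uj' : U j (p (th' j a)) by rewrite th'p.
have Ui' : U i (p (th' j a)) by rewrite th'p.
by apply: (th_trans Uj' Ui').2 => //=; rewrite th'K.
Qed.

Lemma glue_proj_holo : @holomorphic R glueM X p.
Proof.
move=> a; have [i Ua] := coverU (p a).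
rewrite (_ : p = p \o th' i); last by apply/funext => z /=; rewrite th'p.
exact: cdifferentiable_comp (glue_inv_cdifferentiable Ua) (hp _).
Qed.

End Glue.

(** * The torsor of a cocycle *)

Section Twist.
Variables (R : realType) (X Y : cmanifold R) (q : Y -> X) (G : lie_group R).
Variables (phi : deck q -> maps_aut Y G) (B : group_bundle X).
Variable T : frame phi B.
Hypotheses (hq : galois_cover q) (hphi : crossed_morphism phi).
Variable rho : cocycle phi.

Let cq : covering q. Proof. by case: hq. Qed.

(** Deck transformations act simply transitively on the fibres of [q], so as
    soon as holomorphy is dropped every cocycle is a coboundary: prescribe the
    value [1] at one point of each fibre. *)
Lemma cocycle_set_trivial : exists t : Y -> G, forall (f : deck q) y,
  t (f y) = phi f y (lg_mul (t y) (lg_inv (rho f y))).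
Proof.
have [r rK] := choice (covering_surjective cq).
have /choice[c cE] : forall y, exists f : deck q, f (r (q y)) = y.
  by move=> y; have [_ _] := hq; apply; rewrite rK.
exists (fun y => phi (c y) (r (q y)) (lg_inv (rho (c y) (r (q y))))) => f y.
have -> : c (f y) = deck_comp f (c y).
  by apply: (@deck_rigid _ _ _ _ _ _ (r (q (f y))) hq); rewrite cE deck_over /= cE.
rewrite deck_over hphi cE; congr (phi f y _).
by rewrite co_cocycle lg_invM la_mul /maps_act cE -la_inv_inv la_invK.
Qed.

Lemma covering_sections : exists (U : Y -> set X) (s : Y -> X -> Y), forall y,
  [/\ open (U y) /\ U y (q y), (forall x, q (s y x) = x),
      holomorphic_on (U y) (s y) & \forall z \near y, s y (q z) = z].
Proof.
have /choice[a aE] : forall y, exists Us : set X * (X -> Y),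
    [/\ open Us.1 /\ Us.1 (q y), (forall x, q (Us.2 x) = x),
        holomorphic_on Us.1 Us.2 & \forall z \near y, Us.2 (q z) = z].
  move=> y; have [U [V [s [oU Vy sK hs sV]]]] := covering_section y cq.
  exists (U, s); split=> //=; first by split=> //; have [] := sV y Vy.2.
  by apply: filterS (open_nbhs_nbhs Vy) => z /sV[].
by exists (fun y => (a y).1), (fun y => (a y).2).
Qed.

Variable t : Y -> G.
Hypothesis tE : forall (f : deck q) y,
  t (f y) = phi f y (lg_mul (t y) (lg_inv (rho f y))).
Variables (U : Y -> set X) (s : Y -> X -> Y).
Hypothesis Us : forall y,
  [/\ open (U y) /\ U y (q y), (forall x, q (s y x) = x),
      holomorphic_on (U y) (s y) & \forall z \near y, s y (q z) = z].

Let oU y : open (U y). Proof. by have [[]] := Us y. Qed.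
Let sK y x : q (s y x) = x. Proof. by have [_ +] := Us y; exact. Qed.
Let coverU x : exists y, U y x.
Proof.
have [y <-] := covering_surjective cq x.
by exists y; have [[]] := Us y.
Qed.

(** Left translation by the section [x |-> fr T (s i x) (t (s i x))] of [B],
    which need not be holomorphic. *)
Definition twist (i : Y) (b : B) : B := let y := s i (gb_proj b) in
  fr T y (lg_mul (t y) (coord T y b)).

Definition untwist (i : Y) (b : B) : B := let y := s i (gb_proj b) in
  fr T y (lg_mul (lg_inv (t y)) (coord T y b)).

Let twist_over i b : gb_proj (twist i b) = gb_proj b.
Proof. by rewrite fr_proj sK. Qed.

Let untwist_over i b : gb_proj (untwist i b) = gb_proj b.
Proof. by rewrite fr_proj sK. Qed.

Let twistK i : cancel (twist i) (untwist i).
Proof.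
by move=> b; rewrite /untwist twist_over frK lg_mulKg coordK ?sK.
Qed.

Let untwistK i : cancel (untwist i) (twist i).
Proof.
by move=> b; rewrite /twist untwist_over frK lg_mulKVg coordK ?sK.
Qed.

Let twist_mul i a b : gb_proj a = gb_proj b ->
  twist i (gb_mul a b) = gb_mul (twist i a) b.
Proof.
move=> ab; rewrite /twist gb_mul_over// -ab.
set y := s i _; have ya : q y = gb_proj a by exact: sK.
have yb : q y = gb_proj b by rewrite ya.
rewrite -{1}(coordK T ya) -{1 2}(coordK T yb) -!frM frK.
by rewrite lg_mulA.
Qed.

(** Between the sheets [v] and [f v] the two translations differ by
    [rho f v], which is holomorphic in [v]. *)
Lemma untwist_twist i j (f : deck q) b :
  f (s i (gb_proj b)) = s j (gb_proj b) ->
  untwist j (twist i b) = fr T (s i (gb_proj b))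
    (lg_mul (rho f (s i (gb_proj b))) (coord T (s i (gb_proj b)) b)).
Proof.
move=> fij; rewrite /untwist twist_over -fij /twist.
set v := s i _; rewrite -(fr_deck T f v (lg_mul (t v) _)) frK tE.
rewrite -la_invM -la_mul fr_deck.
rewrite lg_invM -lg_mulA lg_mulKg; congr (fr T v (lg_mul _ _)).
by apply/esym/lg_inv_unique; rewrite lg_mulVg.
Qed.

(** Near [b] the sections [s i] and [s j] of the cover differ by one deck
    transformation [f]: [f \o s i] and [s j] agree at the image of [b], take
    values close to their common value there, and the cover is locally
    injective. *)
Lemma twist_transition i j b : U i (gb_proj b) -> U j (gb_proj b) ->
  cdifferentiable (untwist j \o twist i) b.
Proof.
move=> Ui Uj; have hsp k : U k (gb_proj b) ->
    cdifferentiable (fun c : B => s k (gb_proj c)) b.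
  move=> Uk; have [_ _ hsk _] := Us k.
  apply: (cdifferentiable_comp (gb_proj_holo b)).
  by apply: holomorphic_on_cdifferentiable hsk _; exact: open_nbhs_nbhs.
have [f fij] : exists f : deck q, f (s i (gb_proj b)) = s j (gb_proj b).
  by have [_ _] := hq; apply; rewrite !sK.
have [U' [V [r [_ [oV Vw] _ _ rV]]]] := covering_section (s j (gb_proj b)) cq.
pose W : set B := [set c | [/\ U i (gb_proj c), V (f (s i (gb_proj c))) &
  V (s j (gb_proj c))]].
have nW : nbhs b W.
  have nV1 : nbhs b ((fun c : B => f (s i (gb_proj c))) @^-1` V).
    have [cf _] := cdifferentiable_comp (hsp i Ui) (deck_holo f _).
    by apply: cf; apply: open_nbhs_nbhs; rewrite /= fij.
  have nV2 : nbhs b ((fun c : B => s j (gb_proj c)) @^-1` V).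
    by have [cs _] := hsp j Uj; apply: cs; exact: open_nbhs_nbhs.
  have nU : nbhs b (@gb_proj R X B @^-1` U i).
    by apply: open_preimage_nbhs => //; exact: gb_proj_holo.
  by near=> c; split; near: c.
apply: holomorphic_on_cdifferentiable nW.
apply: (@eq_holomorphic_on _ _ _ _ (fun c => fr T (s i (gb_proj c))
    (lg_mul (rho f (s i (gb_proj c))) (coord T (s i (gb_proj c)) c)))).
  move=> c [_ V1 V2]; rewrite /= (@untwist_twist i j f)//.
  have [_ r2] := rV _ V2; have [_ r1] := rV _ V1.
  by rewrite -r1 -r2 deck_over !sK.
have hsi : holomorphic_on W (fun c => s i (gb_proj c)).
  have [_ _ hsi _] := Us i.
  apply: (@holomorphic_on_comp _ B X Y _ (U i) _ (s i)) => //.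
    by move=> c [].
  exact/holomorphic_holomorphic_on/gb_proj_holo.
apply: fr_holomorphic_on => //; apply: lg_mul_holomorphic_on.
  apply: (@holomorphic_on_comp _ B Y G _ setT _ (rho f)) => //.
  exact/holomorphic_holomorphic_on/maps_holo.
apply: coord_holomorphic_on; [by move=> c _; rewrite sK|exact: hsi|].
exact: holomorphic_on_id.
Unshelve. all: by end_near. Qed.

(** The manifold in which each [twist i] is biholomorphic over [U i]. *)
Let P : cmanifold R := glueM (@gb_proj_holo R X B) oU coverU twistK untwistK
  twist_over twist_transition.

Let twist_cdifferentiable i (b : B) :
  U i (gb_proj b) -> @cdifferentiable R B P (twist i) b :=
  @glue_cdifferentiable _ _ _ _ _ _ _ _ _ _ _ _ _ _ _ i b.

Let twist_holo i : @holomorphic_on R B P (@gb_proj R X B @^-1` U i) (twist i).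
Proof.
apply: cdifferentiable_holomorphic_on; last exact: twist_cdifferentiable.
by apply: open_comp (oU i) => a _; exact/holomorphic_continuous/gb_proj_holo.
Qed.

Let untwist_holo i :
  @holomorphic_on R P B (@gb_proj R X B @^-1` U i) (untwist i).
Proof.
apply: (@cdifferentiable_holomorphic_on R P B).
  exact: (glue_open_over (@gb_proj_holo R X B) oU twist_over).
exact: (@glue_inv_cdifferentiable _ _ _ _ _ _ _ _ _ _ _ _ _ _ twist_transition).
Qed.

Let P_proj_holo : @holomorphic R P X (@gb_proj R X B).
Proof.
exact: (@glue_proj_holo _ _ _ _ _ _ _ _ _ _ _ _ _ _ twist_transition).
Qed.

Let P_act_holo : @holomorphic_on R (prodM P B) P
  (fibre_product (@gb_proj R X B) (@gb_proj R X B))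
  (fun ub => gb_mul ub.1 ub.2).
Proof.
apply: holomorphic_on_local => -[u b] /= ub; have [i Uu] := coverU (gb_proj u).
have pu : holomorphic (fun c : prodM P B => gb_proj (c.1 : B) : X).
  apply: (@holomorphic_comp R (prodM P B) P X fst); last exact: P_proj_holo.
  by move=> ?; exact: cdifferentiable_fst.
exists [set c | U i (gb_proj (c.1 : B))].
  exact: (open_preimage_nbhs pu).
apply: (@eq_holomorphic_on R (prodM P B) P _
    (fun c => twist i (gb_mul (untwist i c.1) c.2))).
  by move=> [v c] [/= vc _]; rewrite twist_mul ?untwist_over// untwistK.
apply: (@holomorphic_on_comp R (prodM P B) B P _ (@gb_proj R X B @^-1` U i)
  (fun c => gb_mul (untwist i c.1) c.2) (twist i)) => //.
  by move=> [v c] [/= vc Uv]; rewrite gb_mul_over ?untwist_over// -vc.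
apply: (gb_mul_holomorphic_on T cq).
- by move=> [v c] [/= vc Uv]; rewrite untwist_over.
- apply: (@holomorphic_on_comp R (prodM P B) P B _ (@gb_proj R X B @^-1` U i)
    fst (untwist i)) => //; last exact: holomorphic_on_proj1.
  by move=> c [].
- exact: holomorphic_on_proj2.
Qed.

(** As a set with an action of [B], the torsor is [B] itself with its right
    translations; only the complex structure is twisted. *)
Definition twisted_torsor : torsor B.
Proof.
refine (@Torsor R X B P (@gb_proj R X B) (@gb_mul R X B) P_proj_holo P_act_holo
  _ _ _ _).
- by move=> u b ub; rewrite gb_mul_over.
- by move=> u; have [_ _ /(_ u erefl)[]] := gb_laws B (gb_proj u).
- move=> u a b ua ub; have [_ mA _ _] := gb_laws B (gb_proj u).
  by apply: mA.
- move=> x; have [i Ux] := coverU x.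
  exists (U i), (twist i), (untwist i); split=> //.
    split=> //.
      by move=> a /= Ua; rewrite twist_over twistK.
    by move=> a /= Ua; rewrite untwist_over untwistK.
  by move=> a b _ ab; exact: twist_mul.
Defined.

(** The section is [y |-> fr T y (t y)]: near [y] it is the image under
    [twist y] of the unit section. *)
Lemma twisted_torsor_cocycle : has_cocycle T twisted_torsor rho.
Proof.
exists (fun y => fr T y (t y) : twisted_torsor).
  split=> [y|y]; last by rewrite /= fr_proj.
  have [[_ Uy] _ _ sy] := Us y.
  apply: (@near_cdifferentiable _ _ _ (fun z => twist y (fr T z (lg_one G)) : P)).
    by apply: filterS sy => z sz; rewrite /twist fr_proj sz frK lg_mulg1.
  apply: (@cdifferentiable_comp R Y B P).
    apply: holomorphic_on_cdifferentiable (filterT : nbhs y setT).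
    by apply: fr_holomorphic_on; [exact: holomorphic_on_id | exact: holomorphic_on_cst].
  by apply: twist_cdifferentiable; rewrite fr_proj.
move=> f y; rewrite /ract /= tE fr_deck -frM -lg_mulA lg_mulVg.
by rewrite lg_mulg1.
Qed.

End Twist.

Lemma torsor_of_cocycle (R : realType) (X Y : cmanifold R) (q : Y -> X)
    (G : lie_group R) (phi : deck q -> maps_aut Y G) (B : group_bundle X)
    (T : frame phi B) (rho : cocycle phi) :
  galois_cover q -> crossed_morphism phi ->
  exists P : torsor B, has_cocycle T P rho.
Proof.
move=> hq hphi; have [t tE] := cocycle_set_trivial hq hphi rho.
have [U [s Us]] := covering_sections hq.
by exists (twisted_torsor T hq tE Us); exact: twisted_torsor_cocycle.
Qed.

(** * The classification *)

Section Classes.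
Variables (T C : Type) (E : T -> T -> Prop) (E' : C -> C -> Prop).
Variable rel : T -> C -> Prop.
Hypothesis rel_total : forall x, exists c, rel x c.
Hypothesis rel_surj : forall c, exists x, rel x c.
Hypothesis relE : forall x x' c c',
  rel x c -> rel x' c' -> (E x x' <-> E' c c').

Let predext (S : Type) (A A' : S -> Prop) : (forall z, A z <-> A' z) -> A = A'.
Proof. by move=> AA'; apply/funext => z; exact/propext. Qed.

Let Phi_fun (A : T -> Prop) : C -> Prop :=
  fun c => exists x, A x /\ rel x c.

Let Phi_class x c : rel x c -> Phi_fun (E x) = E' c.
Proof.
move=> xc; apply: predext => d; split=> [[z [xz zd]]|cd].
  by rewrite -(relE xc zd).
by have [z zd] := rel_surj d; exists z; rewrite (relE xc zd).
Qed.

Let Psi_fun (A : C -> Prop) : T -> Prop :=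
  fun x => exists c, A c /\ rel x c.

Let Psi_class x c : rel x c -> Psi_fun (E' c) = E x.
Proof.
move=> xc; apply: predext => z; split=> [[d [cd zd]]|xz].
  by rewrite (relE xc zd).
by have [d zd] := rel_total z; exists d; rewrite -(relE xc zd).
Qed.

(** [rel] sends a class to the set of all elements related to its members, so
    that no representatives are chosen. *)
Lemma eq_classes_bijective :
  exists Phi : eq_classes E -> eq_classes E', bijective Phi.
Proof.
have PhiP (A : eq_classes E) : exists c, Phi_fun (proj1_sig A) = E' c.
  case: A => _ /= [x ->]; have [c xc] := rel_total x.
  by exists c; exact: Phi_class.
have PsiP (A : eq_classes E') : exists x, Psi_fun (proj1_sig A) = E x.
  case: A => _ /= [c ->]; have [x xc] := rel_surj c.
  by exists x; exact: Psi_class.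
exists (fun A => exist (fun A' => exists c, A' = E' c) _ (PhiP A)).
exists (fun A => exist (fun A' => exists x, A' = E x) _ (PsiP A)).
- move=> [A AE]; apply: eq_exist => /=; move: AE => [x ->].
  have [c xc] := rel_total x.
  by rewrite (Phi_class xc) (Psi_class xc).
- move=> [A AE]; apply: eq_exist => /=; move: AE => [c ->].
  have [x xc] := rel_surj c.
  by rewrite (Psi_class xc) (Phi_class xc).
Qed.

End Classes.

Theorem corollary3p16 (R : realType) (X Y : cmanifold R) (q : Y -> X)
    (G : lie_group R) (B : pi_group_bundle q G) (phi : deck q -> maps_aut Y G)
    (hX : connected_manifold X) (hq : galois_cover q)
    (hphi : crossed_morphism phi)
    (hB : exists (Q : group_bundle X) (k : prodM Y G -> Q),
      quotient_bundle phi k /\ group_bundle_iso B Q) :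
  exists Phi : torsor_classes B -> H1 phi, bijective Phi.
Proof.
have [Q [k [hk BQ]]] := hB.
have [fQ] := quotient_frame hq hphi hk.
have [T] := iso_frame BQ fQ; have cq : covering q by case: hq.
apply: (@eq_classes_bijective _ _ _ _
  (fun P rho => has_cocycle T (proj1_sig P) rho)).
- move=> [P tP] /=; have [s ls] := trivial_pullback_section tP.
  by have [rho sE] := lifts_cover_cocycle T hq ls; exists rho, s.
- move=> rho; have [P hP] := torsor_of_cocycle T rho hq hphi.
  have [s ls _] := hP.
  by exists (exist _ P (section_trivial_pullback T cq ls)).
- move=> [P tP] [P' tP'] rho rho' /= hP hP'; split=> [PP'|rr'].
    exact: (has_cocycle_cohomologous hq (iso_has_cocycle PP' hP) hP').
  exact: (has_cocycle_iso hq (cohomologous_has_cocycle rr' hP) hP').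
Qed.
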